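(* Let $\Sigma$ be a discrete-time system $x_i=f_{u_i}(x_{i-1})$ with control in $U\subset\mathbb{R}^m$ satisfying (A1)-(A4), let $x_0\in M$ and let $\bar u=(u_1,\dots,u_N)\in(\mathrm{int}\,U)^N$. If the trajectory of $\Sigma$ corresponding to $x_0$ and $\bar u$ is geometrically optimal, then there exists a nonzero covector $\lambda\in (L_{\bar u}(x_0))^\perp$ such that $$\mathrm{Ind}^-(\lambda H)|_{K_{\bar u}(x_0)}<\mathrm{codim}\,L_{\bar u}(x_0).$$ In particular, if $L_{\bar u}(x_0)$ is the whole tangent space $T_{x_0}M$ then the trajectory is not geometrically optimal. If $\mathrm{codim}\,L_{\bar u}(x_0)=1$, then it is necessary for geometric optimality that there exists a nonzero $\lambda\in (L_{\bar u}(x_0))^\perp$ (unique up to a positive multiplier) such that the quadratic form $\lambda H$ restricted to $K_{\bar u}(x_0)$ is non-negative definite.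
   Context: System: $f:M\times U\to M$, $f_u(x)=f(x,u)$, dynamics $x_i=f_{u_i}(x_{i-1})$. Assumptions: (A1) $M$ is an open subset of $\mathbb{R}^n$ or a smooth manifold of dimension $n$; (A2) $U\subset\mathbb{R}^m$ has nonempty interior and $U$ is contained in the closure of its interior; (A3) $f$ is $C^2$, meaning it has a $C^2$ extension to $M\times\widetilde U$ with $\widetilde U\supset U$ open in $\mathbb{R}^m$; (A4) for each $u\in U$, $f_u$ is a diffeomorphism of $M$ onto an open subset of $M$. Vector fields: for $u=(u^1,\dots,u^m)$ and $r=1,\dots,m$, $X^+_{u,r}(x)=(\mathrm{d}f_u(x))^{-1}\frac{\partial}{\partial u^r}f_u(x)$. For a vector field $Y$, $(\mathrm{Ad}_uY)(x)=(\mathrm{d}f_u(x))^{-1}Y(f_u(x))$. For $\bar u=(u_1,\dots,u_N)$, $u_i=(u_i^1,\dots,u_i^m)$, put $Y^{ir}_{\bar u}=\mathrm{Ad}_{u_1}\cdots\mathrm{Ad}_{u_{i-1}}X^+_{u_i,r}$; $L_{\bar u}(x)=\mathrm{span}\{Y^{ir}_{\bar u}(x): 1\le i\le N,1\le r\le m\}\subset T_xM$ (codimension is taken in $T_xM$); $K_{\bar u}(x)=\{a=(a_i^r)\in\mathbb{R}^{mN}:\sum_{i=1}^N\sum_{r=1}^m a_i^rY^{ir}_{\bar u}(x)=0\}$. Further, $Z^{ir,js}_{\bar u}=Z^{js,ir}_{\bar u}=\frac12[Y^{ir}_{\bar u},Y^{js}_{\bar u}]$ for $i<j$ and $Z^{ir,is}_{\bar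 u}=\mathrm{Ad}_{u_1}\cdots\mathrm{Ad}_{u_{i-1}}\frac{\partial}{\partial u_i^r}X^+_{u_i,s}$, where the Lie bracket in coordinates is $[X,Y]=DY\cdot X-DX\cdot Y$. Define the $T_{x_0}M$-valued quadratic form $H(a)=\sum_{i,j=1}^N\sum_{r,s=1}^m a_i^ra_j^sZ^{ir,js}_{\bar u}(x_0)$ on $\mathbb{R}^{mN}$, and for $\lambda\in T^*_{x_0}M$ the real quadratic form $\lambda H(a)=\lambda(H(a))$. For a subspace $L\subset T_xM$, $L^\perp=\{\lambda\in T_x^*M:\lambda|_L=0\}$. $\mathrm{Ind}^-Q$ is the maximal dimension of a subspace on which the quadratic form $Q$ is strictly negative definite. The reachable set in $i$ steps is $\mathcal R^+(x_0,i)=\{f_{v_i}\circ\cdots\circ f_{v_1}(x_0):(v_1,\dots,v_i)\in U^i\}$. The trajectory $x(i)=f_{u_i}\circ\cdots\circ f_{u_1}(x_0)$, $i=0,\dots,N$, is geometrically optimal if $x(i)\in\partial\mathcal R^+(x_0,i)$ (boundary in $M$) for $i=1,\dots,N$.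
   Formalization: In the codimension-one case, the covector is unique up to a nonzero multiplier, and that multiplier is shown positive only when λH is not identically zero on K; otherwise −λ also qualifies (e.g. f(x,u)=x on M=ℝ), so the literal claim fails. *)

(* Defs.v *)
From HB Require Import structures.
From mathcomp Require Import all_boot all_order all_algebra.
From mathcomp Require Import all_classical all_reals all_analysis.

Set Implicit Arguments.
Unset Strict Implicit.
Unset Printing Implicit Defensive.

Import Order.TTheory GRing.Theory Num.Theory.
Import numFieldNormedType.Exports.

Local Open Scope classical_set_scope.
Local Open Scope ring_scope.

Section Smoothness.
Context {R : realType}.

(* [f] is of class C^k on [D]; [D] is always an open subset of a
   finite-dimensional space below, so that continuity of all directional
   derivatives is continuity of the differential. *)
Fixpoint Ck_on (V W : normedModType R) (k : nat) (D : set V) (f : V -> W)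
    : Prop :=
  match k with
  | 0 => forall x, D x -> {for x, continuous f}
  | k'.+1 => (forall x, D x -> differentiable f x) /\
             (forall v, Ck_on k' D ('D_v f))
  end.

Definition smooth_on (V W : normedModType R) (D : set V) (f : V -> W) : Prop :=
  forall k, Ck_on k D f.

End Smoothness.

(* A homeomorphism from the open set [cdom] of [M] onto the open set [cimg] of
   R^n.  The values of [cmap] off [cdom] and of [cinv] off [cimg] are
   irrelevant. *)
Record chart (R : realType) (n : nat) (M : topologicalType) := Chart {
  cdom : set M;
  cimg : set 'rV[R]_n;
  cmap :> M -> 'rV[R]_n;
  cinv : 'rV[R]_n -> M;
  cdom_open : open cdom;
  cimg_open : open cimg;
  cmap_cimg : forall x, cdom x -> cimg (cmap x);
  cinv_cdom : forall y, cimg y -> cdom (cinv y);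
  cmapK : forall x, cdom x -> cinv (cmap x) = x;
  cinvK : forall y, cimg y -> cmap (cinv y) = y;
  cmap_continuous : forall x, cdom x -> {for x, continuous cmap};
  cinv_continuous : forall y, cimg y -> {for y, continuous cinv}
}.

(* The structure comes with a (completely arbitrary) choice [chart_at x] of a
   chart around each point x.  The tangent space T_x M is R^n, a tangent vector
   at x being given by its coordinates in [chart_at x]; accordingly a vector
   field is a function M -> R^n whose value at x is read in [chart_at x]. *)
Record smooth_manifold (R : realType) (n : nat) (M : topologicalType) :=
  SmoothManifold {
  atlas : set (chart R n M);
  chart_at : M -> chart R n M;
  chart_at_atlas : forall x, atlas (chart_at x);
  chart_at_cdom : forall x, cdom (chart_at x) x;
  atlas_compat : forall phi psi, atlas phi -> atlas psi ->
    smooth_on (cimg phi `&` cinv phi @^-1` cdom psi) (psi \o cinv phi);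
  manifold_hausdorff : hausdorff_space M;
  manifold_second_countable : @second_countable M
}.

Definition vfield (R : realType) (n : nat) (M : topologicalType) : Type :=
  M -> 'rV[R]_n.

Section Manifold.
Context {R : realType} {n : nat} {M : topologicalType}.
Variable S : smooth_manifold R n M.

Definition Ck_map_on (k : nat) (D : set M) (g : M -> M) : Prop :=
  (forall x, D x -> {for x, continuous g}) /\
  (forall phi psi, atlas S phi -> atlas S psi ->
    Ck_on k [set y | [/\ cimg phi y, D (cinv phi y)
                       & cdom psi (g (cinv phi y))]]
            (fun y => psi (g (cinv phi y)))).

(* [g] is of class C^k on the open subset M x O of M x R^m *)
Definition Ck_family_on (m k : nat) (O : set 'rV[R]_m)
    (g : M -> 'rV[R]_m -> M) : Prop :=
  (forall x u, O u -> {for (x, u), continuous (fun p => g p.1 p.2)}) /\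
  (forall phi psi, atlas S phi -> atlas S psi ->
    Ck_on k [set p : 'rV[R]_n * 'rV[R]_m |
              [/\ cimg phi p.1, O p.2 & cdom psi (g (cinv phi p.1) p.2)]]
            (fun p => psi (g (cinv phi p.1) p.2))).

(* The values of [f] outside M x U play no role. *)
Definition has_Ck_extension (m k : nat) (U : set 'rV[R]_m)
    (f : M -> 'rV[R]_m -> M) : Prop :=
  exists (O : set 'rV[R]_m) (g : M -> 'rV[R]_m -> M),
    [/\ open O, U `<=` O, Ck_family_on k O g
      & forall x u, U u -> g x u = f x u].

Definition Ck_diffeo_onto_open (k : nat) (g : M -> M) : Prop :=
  [/\ open (range g), Ck_map_on k setT g
    & exists h : M -> M, cancel g h /\ Ck_map_on k (range g) h].

(* The differential dg(x) : T_x M -> T_(g x) M; as for the library's Jacobian,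
   it acts on row vectors by multiplication on the right. *)
Definition dmap (g : M -> M) (x : M) : 'M[R]_n :=
  'J (fun y => chart_at S (g x) (g (cinv (chart_at S x) y))) (chart_at S x x).

(* coordinate expression of a vector field in the chart phi *)
Definition vf_coord (phi : chart R n M) (X : vfield R n M) (y : 'rV[R]_n)
    : 'rV[R]_n :=
  let p := cinv phi y in
  X p *m 'J (phi \o cinv (chart_at S p)) (chart_at S p p).

Definition lie_bracket (X Y : vfield R n M) : vfield R n M := fun x =>
  let phi := chart_at S x in
  vf_coord phi X (phi x) *m 'J (vf_coord phi Y) (phi x)
  - vf_coord phi Y (phi x) *m 'J (vf_coord phi X) (phi x).

End Manifold.

Section LinearAlgebra.
Context {R : realType} {V : vectType R}.

Definition codimv (L : {vspace V}) : nat := (\dim {:V} - \dim L)%N.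

Definition annihilator (L : {vspace V}) : set 'Hom(V, R^o) :=
  [set lam | forall v, v \in L -> lam v = 0].

(* Ind^- of the restriction of Q to K *)
Definition neg_index (Q : V -> R) (K : {vspace V}) : nat :=
  \max_(d < (\dim K).+1 |
     `[< exists W : {vspace V}, [/\ (W <= K)%VS, \dim W = d
           & forall a, a \in W -> a != 0 -> Q a < 0] >]) (d : nat).

End LinearAlgebra.

Section Boundary.
Context {T : topologicalType}.

Definition boundary (A : set T) : set T := closure A `\` interior A.

End Boundary.

Section System.
Context {R : realType} {n m : nat} {M : topologicalType}.
Variable S : smooth_manifold R n M.
Variable f : M -> 'rV[R]_m -> M.

Definition reachable (U : set 'rV[R]_m) (x0 : M) (i : nat) : set M :=
  [set foldl f x0 v | v in [set v : i.-tuple 'rV[R]_m |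
                             forall j, U (tnth v j)]].

Definition geometrically_optimal (N : nat) (U : set 'rV[R]_m) (x0 : M)
    (ubar : N.-tuple 'rV[R]_m) : Prop :=
  forall i, (1 <= i <= N)%N ->
    boundary (reachable U x0 i) (foldl f x0 (take i ubar)).

Local Notation e_ r := (delta_mx 0 r : 'rV[R]_m).

Definition Xplus (u : 'rV[R]_m) (r : 'I_m) : vfield R n M := fun x =>
  'D_(e_ r) (fun v => chart_at S (f x u) (f x v)) u
    *m invmx (dmap S (f^~ u) x).

Definition Ad (u : 'rV[R]_m) (Y : vfield R n M) : vfield R n M := fun x =>
  Y (f x u) *m invmx (dmap S (f^~ u) x).

(* X^+_{v,s}(x) stays in T_x M when v varies *)
Definition dXplus (u : 'rV[R]_m) (r s : 'I_m) : vfield R n M := fun x =>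
  'D_(e_ r) (fun v => Xplus v s x) u.

Variables (N : nat) (ubar : N.-tuple 'rV[R]_m).

(* Indices start at 0: for i : 'I_N, [take i ubar] lists the controls strictly
   before [tnth ubar i]. *)
Definition Ad_before (i : 'I_N) (Y : vfield R n M) : vfield R n M :=
  foldr Ad Y (take i ubar).

Definition Yfield (i : 'I_N) (r : 'I_m) : vfield R n M :=
  Ad_before i (Xplus (tnth ubar i) r).

Definition Lsub (x : M) : {vspace 'rV[R]_n} :=
  <<[seq Yfield p.1 p.2 x | p : 'I_N * 'I_m]>>%VS.

Definition Ycomb (x : M) (a : 'M[R]_(N, m)) : 'rV[R]_n :=
  \sum_(i < N) \sum_(r < m) a i r *: Yfield i r x.

Definition Ksub (x : M) : {vspace 'M[R]_(N, m)} := lker (linfun (Ycomb x)).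

Definition Zfield (i : 'I_N) (r : 'I_m) (j : 'I_N) (s : 'I_m)
    : vfield R n M := fun x =>
  if (i < j)%N then 2^-1 *: lie_bracket S (Yfield i r) (Yfield j s) x
  else if (j < i)%N then 2^-1 *: lie_bracket S (Yfield j s) (Yfield i r) x
  else Ad_before i (dXplus (tnth ubar i) r s) x.

Definition Hform (x0 : M) (a : 'M[R]_(N, m)) : 'rV[R]_n :=
  \sum_(i < N) \sum_(j < N) \sum_(r < m) \sum_(s < m)
    (a i r * a j s) *: Zfield i r j s x0.

Definition lamH (x0 : M) (lam : 'Hom('rV[R]_n, R^o)) (a : 'M[R]_(N, m)) : R :=
  lam (Hform x0 a).

Fact Ycomb_is_linear (x : M) : linear (Ycomb x).
Proof.
move=> c a b; rewrite /Ycomb scaler_sumr -big_split /=.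
apply: eq_bigr => i _; rewrite scaler_sumr -big_split /=.
by apply: eq_bigr => r _; rewrite !mxE scalerDl scalerA.
Qed.

HB.instance Definition _ (x : M) :=
  GRing.isLinear.Build R 'M[R]_(N, m) 'rV[R]_n _ (Ycomb x) (Ycomb_is_linear x).

(* [linfun] is only meaningful on linear functions *)
Lemma mem_Ksub (x : M) (a : 'M[R]_(N, m)) :
  (a \in Ksub x) = (Ycomb x a == 0).
Proof. by rewrite memv_ker lfunE. Qed.

End System.

(* Main.v *)
Require Import Defs.
From HB Require Import structures.
From mathcomp Require Import all_boot all_order all_algebra.
From mathcomp Require Import all_classical all_reals all_analysis.
From mathcomp Require Import perm ring lra zify ssrAC.

Set Implicit Arguments.
Unset Strict Implicit.
Unset Printing Implicit Defensive.

Import Order.TTheory GRing.Theory Num.Theory.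
Import numFieldNormedType.Exports.
Local Open Scope classical_set_scope.
Local Open Scope ring_scope.

(* Write the end point in a chart as a C^2 function F of a perturbation w of the
   controls, F 0 being the end point of the given trajectory.

   Suppose that F 0 is not interior to the image of small balls.  Choose y
   outside the image, close to F 0, and minimise |F w - y| + rho |w|^2
   (Euclidean norms) over a ball, with rho small but |F 0 - y| much smaller than
   rho.  The minimiser a is close to 0, and with lam = (F a - y) / |F a - y| the
   first and second order conditions say that lam . DF(a) is small and that
   lam . D^2F(a)(v, v) + 2 rho |v|^2 >= 0 on {v | DF(a) v is parallel to lam}, a
   subspace of codimension at most n - 1.  As y tends to F 0, compactness yields a
   unit vector lam orthogonal to the image of DF(0) and such that dim V +
   rank DF(0) < n whenever lam . D^2F(0) is negative definite on a subspace V of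
   the kernel of DF(0).

   It remains to compute two derivatives.  Let Phi_i be the first i steps with the
   unperturbed controls, and Y_j = sum_r a_j^r Y^(jr), eta_i = sum_(j < i) Y_j.
   By induction on i the first variation of the state after i steps is
   DPhi_i(eta_i), and the second one is DPhi_i(psi_i) + D^2Phi_i(eta_i, eta_i) with
   psi_i = sum_(j < i) (Z_j + 2 DY_j(eta_j) + DY_j(Y_j)).  When eta_N = 0, that is
   for a in K, symmetrising shows that psi_N = H(a), so that the first and second
   derivatives of F are the images of sum_j Y_j and H(a) under the isomorphism
   DPhi_N, and the covector of the theorem is lam o DPhi_N. *)

(** * Maps of class C^k *)

(** The Hessian of |F - y| at distance d from y contains the term (|DF(a) w|^2 - (lam . DF(a) w)^2)
    / d, which blows up as y tends to F 0. It vanishes exactly when DF(a) w is parallel to lam. This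
    is why the second order condition is only kept on that subspace, and why the count loses n - 1
    dimensions instead of n, which makes the final inequality strict. The kernel of DF(a) may be
    smaller than that of DF(0), so V itself cannot be carried to the nearby point a. It is enlarged
    by a complement C of the kernel of DF(0): if dim (V + C) >= n, every DF(a) sends some unit
    vector of V + C into the line of lam, and a limit of such vectors is killed by DF(0), hence lies
    in V, where the form is negative. In the geometric half the obstacle is the inverse differential
    in Ad and X^+. Each field is replaced by the equation that its push-forward satisfies;
    differentiating that equation only requires knowing beforehand that the field is differentiable.
    Moreover [chart_at] may jump from point to point, so all computations take place in the fixed
    charts at the points of the given trajectory. *)

Section Calculus.
Context {R : realType}.
Implicit Types (V W E : normedModType R).

Lemma near_eq_differentiable V W (f g : V -> W) x :
  (\near x, f x = g x) -> differentiable f x -> differentiable g x.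
Proof.
move=> fg df; apply/diff_locallyP.
have fgx : f x = g x := nbhs_singleton fg.
pose dL : {linear V -> W} := 'd f x.
have cd : continuous dL by exact: diff_continuous.
suff H : g \o shift x = cst (g x) + dL +o_ (0 : V) id.
  by rewrite (diff_unique cd H); split.
apply/eqaddoP => _/posnumP[e].
have /diff_locallyP[_ /eqaddoP/(_ e%:num)/(_ [gt0 of e%:num])] := df.
apply: filter_app.
have : \forall k \near (0 : V), f (k + x) = g (k + x).
  by rewrite (near_shift x 0)/= sub0r; near do rewrite /= subrK; exact: fg.
apply: filter_app; near=> k => fgk.
by rewrite /= -[((_ - _) k)]/(f (k + x) - (f x + _)) -[((_ - _) k)]/(g (k + x) - (g x + _)) fgk fgx.
Unshelve. all: by end_near. Qed.

Lemma is_diff_scale V W (k dk : V -> R) (g dg : V -> W) x :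
  is_diff x k dk -> is_diff x g dg ->
  is_diff x (fun y => k y *: g y) (fun v => k x *: dg v + dk v *: g x).
Proof.
move=> dkx dgx.
have bil : bilinear_for (GRing.Scale.Law.clone _ _ *:%R _)
    (GRing.Scale.Law.clone _ _ *:%R _) ( *:%R : R -> W -> W).
  split=> [u'|u] a y z /=.
  - by rewrite scalerDl -scalerA.
  - by rewrite scalerDr !scalerA mulrC.
pose bM := bilinear_isBilinear.Build R R W W _ _ ( *:%R : R -> W -> W) bil.
pose b : {bilinear R -> W -> W} := HB.pack ( *:%R : R -> W -> W) bM.
have bc : continuous (fun p => b p.1 p.2) by exact: scale_continuous.
have := @is_diff_comp _ _ _ _ (fun y => (k y, g y)) (fun y => (dk y, dg y))
  (fun p : R * W => b p.1 p.2) (fun q => b (k x) q.2 + b q.1 (g x)) x.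
apply.
apply: DiffDef; first exact: differentiable_bilin.
exact: (@diff_bilin _ _ _ _ b (k x, g x)).
Qed.

Lemma differentiable_scale V W (k : V -> R) (g : V -> W) x :
  differentiable k x -> differentiable g x ->
  differentiable (fun y => k y *: g y) x.
Proof.
by move=> /differentiableP dk /differentiableP dg; have [] := is_diff_scale dk dg.
Qed.

Lemma derive_scale V W (k : V -> R) (g : V -> W) x v :
  differentiable k x -> differentiable g x ->
  'D_v (fun y => k y *: g y) x = k x *: 'D_v g x + 'D_v k x *: g x.
Proof.
move=> dk dg; rewrite !deriveE//; last exact: differentiable_scale.
by have [_ ->] := is_diff_scale (differentiableP dk) (differentiableP dg).
Qed.

Lemma differentiable_bigsum V W (I : finType) (h : I -> V -> W) x :
  (forall i, differentiable (h i) x) ->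
  differentiable (fun y => \sum_i h i y) x.
Proof.
move=> dh; have -> : (fun y => \sum_i h i y) = \sum_i h i.
  by apply/funext => y; rewrite fct_sumE.
elim/big_ind : _ => [|f g|//]; [exact: differentiable_cst|exact: differentiableD].
Qed.

Lemma derive_bigsum V W (I : finType) (h : I -> V -> W) x v :
  (forall i, differentiable (h i) x) ->
  'D_v (fun y => \sum_i h i y) x = \sum_i 'D_v (h i) x.
Proof.
move=> dh.
have -> : (fun y => \sum_i h i y) = \sum_i h i.
  by apply/funext => y; rewrite fct_sumE.
suff [] : differentiable (\sum_i h i) x /\ 'D_v (\sum_i h i) x = \sum_i 'D_v (h i) x by [].
elim/big_rec2 : _ => [|i F G _ [dG <-]].
  by split; [exact: differentiable_cst|exact: derive_cst].
split; first exact: differentiableD.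
by rewrite deriveD//; exact: diff_derivable.
Qed.

Lemma derive_comp V E W (f : V -> E) (g : E -> W) x v :
  differentiable f x -> differentiable g (f x) ->
  'D_v (g \o f) x = 'D_('D_v f x) g (f x).
Proof.
move=> df dg; rewrite !deriveE//; last exact: differentiable_comp.
by rewrite diff_comp.
Qed.

Lemma derive_linear V W (l : {linear V -> W}) x v :
  continuous l -> 'D_v l x = l v.
Proof.
by move=> lc; rewrite deriveE ?diff_lin//; exact: linear_differentiable.
Qed.

Lemma derive_linear_comp V E W (l : {linear E -> W}) (f : V -> E) x v :
  continuous l -> differentiable f x -> 'D_v (l \o f) x = l ('D_v f x).
Proof.
move=> lc df; rewrite derive_comp ?derive_linear//.
exact: linear_differentiable.
Qed.

End Calculus.

Section Ck.
Context {R : realType}.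
Implicit Types (V W E : normedModType R).

Lemma Ck_on_sub V W k (D D' : set V) (f : V -> W) :
  D' `<=` D -> Ck_on k D f -> Ck_on k D' f.
Proof.
move=> DD; elim: k f => [|k IH] f /= H; first by move=> x /DD/H.
by case: H => H1 H2; split => [x /DD/H1//|v]; exact: IH.
Qed.

Lemma Ck_on_ext V W k (D : set V) (f g : V -> W) :
  open D -> (forall x, D x -> f x = g x) -> Ck_on k D f -> Ck_on k D g.
Proof.
move=> oD; elim: k f g => [|k IH] f g fg /= H.
  move=> x Dx; have fgx := fg _ Dx.
  have nfg : \forall y \near x, f y = g y.
    by move: (open_nbhs_nbhs (conj oD Dx)); apply: filterS.
  have := H _ Dx; rewrite /prop_for /continuous_at -fgx => fc.
  by apply: cvg_trans fc; apply: near_eq_cvg.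
have nfg x : D x -> \forall y \near x, f y = g y.
  by move=> Dx; move: (open_nbhs_nbhs (conj oD Dx)); apply: filterS.
case: H => H1 H2; split=> [x Dx|v].
  exact: near_eq_differentiable (nfg _ Dx) (H1 _ Dx).
by apply: IH (H2 v) => x Dx; exact: near_eq_derive (nfg _ Dx).
Unshelve. all: by end_near. Qed.

Lemma Ck_on_S V W k (D : set V) (f : V -> W) : Ck_on k.+1 D f -> Ck_on k D f.
Proof.
elim: k f => [|k IH] f [H1 H2].
  by move=> x Dx; exact: differentiable_continuous (H1 _ Dx).
by split => // v; exact: IH.
Qed.

Lemma Ck_on_diff V W k (D : set V) (f : V -> W) x :
  Ck_on k.+1 D f -> D x -> differentiable f x.
Proof. by move=> [H _]; exact: H. Qed.

Lemma Ck_on_cst V W k (D : set V) (a : W) : Ck_on k D (fun=> a).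
Proof.
elim: k a => [|k IH] a /=; first by move=> x _; exact: cst_continuous.
split => [x _|v]; first exact: differentiable_cst.
suff -> : 'D_v (fun=> a) = (fun=> 0) :> (V -> W) by [].
by apply/funext => x; exact: derive_cst.
Qed.

Lemma Ck_on_linear V W k (D : set V) (l : {linear V -> W}) :
  continuous l -> Ck_on k D l.
Proof.
move=> lc; case: k => [|k] /=; first by move=> x _; exact: lc.
split => [x _|v]; first exact: linear_differentiable.
have -> : 'D_v l = (fun=> l v) :> (V -> W).
  by apply/funext => x; exact: derive_linear.
exact: Ck_on_cst.
Qed.

Lemma Ck_on_linear_comp V E W k (D : set V) (l : {linear E -> W}) (f : V -> E) :
  open D -> continuous l -> Ck_on k D f -> Ck_on k D (l \o f).
Proof.
move=> oD lc; elim: k f => [|k IH] f /= H.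
  by move=> x Dx; apply: continuous_comp; [exact: H|exact: lc].
case: H => H1 H2; split => [x Dx|v].
  apply: differentiable_comp; [exact: H1|exact: linear_differentiable].
apply: (@Ck_on_ext _ _ _ _ (l \o 'D_v f)) => //; last exact: IH.
by move=> x Dx /=; rewrite derive_linear_comp//; exact: H1.
Qed.

Lemma Ck_on_add V W k (D : set V) (f g : V -> W) :
  open D -> Ck_on k D f -> Ck_on k D g -> Ck_on k D (f + g).
Proof.
move=> oD; elim: k f g => [|k IH] f g /= Hf Hg.
  by move=> x Dx; exact: cvgD (Hf _ Dx) (Hg _ Dx).
case: Hf Hg => f1 f2 [g1 g2]; split=> [x Dx|v].
  by apply: differentiableD; [exact: f1|exact: g1].
apply: (@Ck_on_ext _ _ _ _ ('D_v f + 'D_v g)) => //; last exact: IH.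
move=> x Dx; rewrite deriveD//; apply: diff_derivable; [exact: f1|exact: g1].
Qed.

Lemma Ck_on_sum V W k (D : set V) (I : finType) (h : I -> V -> W) :
  open D -> (forall i, Ck_on k D (h i)) -> Ck_on k D (fun x => \sum_i h i x).
Proof.
move=> oD H; have -> : (fun y => \sum_i h i y) = \sum_i h i.
  by apply/funext => y; rewrite fct_sumE.
elim/big_ind : _ => [|f g|//]; [exact: Ck_on_cst|exact: Ck_on_add].
Qed.

Lemma Ck_on_scale V W k (D : set V) (c : V -> R) (f : V -> W) :
  open D -> Ck_on k D c -> Ck_on k D f -> Ck_on k D (fun x => c x *: f x).
Proof.
move=> oD; elim: k c f => [|k IH] c f Hc Hf.
  by move=> x Dx; exact: cvgZ (Hc _ Dx) (Hf _ Dx).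
have [c1 c2] := Hc; have [f1 f2] := Hf.
split=> [x Dx|v].
  by apply: differentiable_scale; [exact: c1|exact: f1].
apply: (@Ck_on_ext _ _ _ _ ((fun x => c x *: 'D_v f x) + (fun x => 'D_v c x *: f x))) => //.
  move=> x Dx; rewrite derive_scale//; [exact: c1|exact: f1].
by apply: Ck_on_add => //; apply: IH => //; solve [exact: Ck_on_S|exact: c2|exact: f2].
Qed.

(* [Ck_on] only speaks of derivatives in fixed directions; the chain rule expands
   the varying direction in finitely many coordinates of the intermediate space. *)
Record coords E := Coords {
  cidx : finType;
  cvec : cidx -> E;
  cfun : cidx -> {linear E -> R};
  cfun_continuous : forall j, continuous (cfun j);
  coordsE : forall x, x = \sum_j cfun j x *: cvec j }.

Arguments cvec {E} c j.
Arguments cfun {E} c j.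
Arguments cfun_continuous {E} c j.

Lemma diff_coords E W (c : coords E) (g : E -> W) y w :
  differentiable g y -> 'D_w g y = \sum_j cfun c j w *: 'D_(cvec c j) g y.
Proof.
move=> dg; rewrite deriveE// {1}(coordsE c w) linear_sum.
by apply: eq_bigr => j _; rewrite linearZ/= deriveE.
Qed.

Lemma Ck_on_comp V E W (c : coords E) k (D : set V) (D' : set E)
    (f : V -> E) (g : E -> W) :
  open D -> (forall x, D x -> D' (f x)) ->
  Ck_on k D f -> Ck_on k D' g -> Ck_on k D (g \o f).
Proof.
move=> oD DD'; elim: k f g DD' => [|k IH] f g DD' Hf Hg.
  by move=> x Dx; apply: continuous_comp; [exact: Hf|apply: Hg; exact: DD'].
have [f1 f2] := Hf; have [g1 g2] := Hg.
split=> [x Dx|v].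
  by apply: differentiable_comp; [exact: f1|apply: g1; exact: DD'].
apply: (@Ck_on_ext _ _ _ _
  (fun x => \sum_j (cfun c j \o 'D_v f) x *: ('D_(cvec c j) g \o f) x)) => //.
  move=> x Dx; rewrite derive_comp/= -?(diff_coords c) //.
  - exact/g1/DD'.
  - exact: f1.
  - exact/g1/DD'.
apply: Ck_on_sum => // j; apply: Ck_on_scale => //.
  by apply: Ck_on_linear_comp => //; [exact: cfun_continuous|exact: f2].
by apply: IH => //; [exact: Ck_on_S|exact: g2].
Qed.

End Ck.
Arguments cvec {R E} c j.
Arguments cfun {R E} c j.
Arguments cfun_continuous {R E} c j.

(** * Linear coordinates on row vectors and on products *)

Section Coords.
Context {R : realType}.
Implicit Types (V W E : normedModType R).

Definition pairl E1 E2 (x : E1) : E1 * E2 := (x, 0).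
Definition pairr E1 E2 (x : E2) : E1 * E2 := (0, x).

Lemma pairl_is_linear E1 E2 : linear (@pairl E1 E2).
Proof. by move=> a x y; congr pair; rewrite /= scaler0 addr0. Qed.
HB.instance Definition _ E1 E2 := GRing.isLinear.Build R E1 (E1 * E2)%type _
  (@pairl E1 E2) (@pairl_is_linear E1 E2).
Lemma pairr_is_linear E1 E2 : linear (@pairr E1 E2).
Proof. by move=> a x y; congr pair; rewrite /= scaler0 addr0. Qed.
HB.instance Definition _ E1 E2 := GRing.isLinear.Build R E2 (E1 * E2)%type _
  (@pairr E1 E2) (@pairr_is_linear E1 E2).

Lemma pairl_continuous E1 E2 : continuous (@pairl E1 E2).
Proof. by move=> x; apply: cvg_pair => //=; exact: cvg_cst. Qed.

Lemma pairr_continuous E1 E2 : continuous (@pairr E1 E2).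
Proof. by move=> x; apply: cvg_pair => //=; exact: cvg_cst. Qed.

Lemma pairE E1 E2 (a : E1) (b : E2) : (a, b) = pairl E2 a + pairr E1 b.
Proof. by congr pair; rewrite /= ?addr0 ?add0r. Qed.

Lemma Ck_on_pair V E1 E2 k (D : set V) (f : V -> E1) (g : V -> E2) :
  open D -> Ck_on k D f -> Ck_on k D g -> Ck_on k D (fun x => (f x, g x)).
Proof.
move=> oD Hf Hg.
have -> : (fun x => (f x, g x)) = (@pairl E1 E2 \o f) + (@pairr E1 E2 \o g).
  by apply/funext => x; rewrite pairE.
apply: Ck_on_add => //; apply: Ck_on_linear_comp => //.
- exact: pairl_continuous.
- exact: pairr_continuous.
Qed.

Lemma coord_rV_is_linear n (j : 'I_n) : linear (fun x : 'rV[R]_n => x 0 j).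
Proof. by move=> a x y; rewrite !mxE. Qed.
Definition coord_rV n (j : 'I_n) : {linear 'rV[R]_n -> R} :=
  HB.pack (fun x : 'rV[R]_n => x 0 j)
    (GRing.isLinear.Build R 'rV[R]_n R _ _ (coord_rV_is_linear j)).

Lemma coord_rV_continuous n (j : 'I_n) : continuous (coord_rV j).
Proof. exact: coord_continuous. Qed.

Lemma coords_rV_subproof n (x : 'rV[R]_n) :
  x = \sum_j coord_rV j x *: delta_mx 0 j.
Proof. exact: row_sum_delta. Qed.

Definition coords_rV n := Coords (@coord_rV_continuous n) (@coords_rV_subproof n).

Section prod.
Variables (E1 E2 : normedModType R) (c1 : coords E1) (c2 : coords E2).

Definition prod_cvec (j : cidx c1 + cidx c2) : E1 * E2 :=
  match j with inl i => pairl E2 (cvec c1 i) | inr i => pairr E1 (cvec c2 i) end.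
Definition prod_cfun (j : cidx c1 + cidx c2) : {linear (E1 * E2)%type -> R} :=
  match j with inl i => cfun c1 i \o fst | inr i => cfun c2 i \o snd end.
Lemma prod_cfun_continuous j : continuous (prod_cfun j).
Proof.
case: j => i x /=; apply: continuous_comp; [exact: cvg_fst|exact: cfun_continuous|exact: cvg_snd|exact: cfun_continuous].
Qed.
Lemma prod_coordsE x : x = \sum_j prod_cfun j x *: prod_cvec j.
Proof.
rewrite big_sumType/=; case: x => a b /=; rewrite pairE; congr (_ + _).
  by rewrite {1}(coordsE c1 a) linear_sum; apply: eq_bigr => i _; rewrite linearZ.
by rewrite {1}(coordsE c2 b) linear_sum; apply: eq_bigr => i _; rewrite linearZ.
Qed.
Definition coords_prod := Coords prod_cfun_continuous prod_coordsE.
End prod.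

End Coords.

(** * Second derivatives as bilinear maps *)

Section Second.
Context {R : realType}.
Implicit Types (V W E : normedModType R).

(** The value D^2 g(x)(v, w), with the derivative along [w] taken first. Linearity in [w] is direct
    for C^2 maps; linearity in [v] is obtained from it through symmetry. *)
Definition hess V W (g : V -> W) (x v w : V) : W := 'D_v ('D_w g) x.

Lemma near_open V (D : set V) x (P : V -> Prop) :
  open D -> D x -> (forall y, D y -> P y) -> \forall y \near x, P y.
Proof. by move=> oD Dx H; move: (open_nbhs_nbhs (conj oD Dx)); exact: filterS. Qed.

Lemma derive_dir_linear V W (g : V -> W) x a u v : differentiable g x ->
  'D_(a *: u + v) g x = a *: 'D_u g x + 'D_v g x.
Proof. by move=> dg; rewrite !deriveE// linearP. Qed.

Lemma hess_linearr V W (D : set V) (g : V -> W) x v :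
  open D -> Ck_on 2 D g -> D x -> linear (fun w => hess g x v w).
Proof.
move=> oD [g1 g2] Dx a u w; rewrite /hess.
have [/(_ _ Dx) du _] := g2 u; have [/(_ _ Dx) dw _] := g2 w.
rewrite (@near_eq_derive _ _ _ _ (a *: 'D_u g + 'D_w g)); last first.
  by apply: near_open oD Dx _ => y Dy; rewrite derive_dir_linear//; exact: g1.
rewrite deriveD ?deriveZ//; try exact: diff_derivable.
by apply: diff_derivable; exact: differentiableZ.
Qed.

(** The product rule for Dg(f y)(h y), where base point and direction both move. It yields the
    second variation of the flow as well as the differentiated equations for the fields Y and X^+.
    Expanding [h y] in coordinates leaves derivatives in fixed directions with scalar
    coefficients. *)
Lemma derive_along V E W (c : coords E) (D : set E) (f h : V -> E)
    (g : E -> W) x v :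
  open D -> D (f x) -> Ck_on 2 D g -> differentiable f x -> differentiable h x ->
  'D_v (fun y => 'D_(h y) g (f y)) x =
  'D_('D_v h x) g (f x) + hess g (f x) ('D_v f x) (h x).
Proof.
move=> oD Dfx Cg df dh; have [g1 g2] := Cg.
rewrite (@near_eq_derive _ _ _ _ (fun y => \sum_j (cfun c j \o h) y *: ('D_(cvec c j) g \o f) y)); last first.
  have := differentiable_continuous df (open_nbhs_nbhs (conj oD Dfx)).
  rewrite nbhs_simpl/=; apply: filterS => y Dfy.
  by rewrite -(diff_coords c)//; exact: g1.
have dcj j : differentiable (cfun c j) (h x).
  by apply: linear_differentiable; exact: cfun_continuous.
have d1 j : differentiable (cfun c j \o h) x by exact: differentiable_comp.
have d2' j : differentiable ('D_(cvec c j) g) (f x).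
  by have [H _] := g2 (cvec c j); exact: H.
have d2 j : differentiable ('D_(cvec c j) g \o f) x by exact: differentiable_comp.
rewrite derive_bigsum; last by move=> j; exact: differentiable_scale.
under eq_bigr do rewrite derive_scale//.
rewrite big_split/= addrC; congr (_ + _).
  rewrite [RHS](diff_coords c); last exact: g1.
  by apply: eq_bigr => j _; rewrite derive_linear_comp//; exact: cfun_continuous.
pose hL : {linear E -> W} := HB.pack (hess g (f x) ('D_v f x))
  (GRing.isLinear.Build R E W _ _ (hess_linearr ('D_v f x) oD Cg Dfx)).
rewrite -[RHS]/(hL (h x)) {2}(coordsE c (h x)) linear_sum.
apply: eq_bigr => j _; rewrite linearZ/=; congr (_ *: _).
by rewrite derive_comp.
Qed.

End Second.

(** * Symmetry of second derivatives *)

Section Schwarz.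
Context {R : realType}.
Implicit Types (V W E : normedModType R).

Lemma is_derive_line V W (g : V -> W) (p v : V) (s : R) :
  differentiable g (p + s *: v) ->
  is_derive s 1 (fun t => g (p + t *: v)) ('D_v g (p + s *: v)).
Proof.
move=> dg; pose l (t : R) := p + t *: v.
have dl : is_diff s l ( *:%R ^~ v).
  rewrite (_ : l = cst p + *:%R ^~ v); last exact/funext.
  by apply: is_diff_eq; rewrite add0r.
have dgl : differentiable (g \o l) s by apply: differentiable_comp.
split; first exact: diff_derivable.
rewrite (@deriveE _ _ _ (g \o l))// diff_comp//= [X in 'd g _ (X _)]diff_val.
by rewrite scale1r deriveE.
Qed.

(** If c < 0, then [dpsi] is negative just to the right of 0, and by the mean value theorem [psi]
    drops below [psi 0] there. *)
Lemma second_order_min (psi dpsi : R -> R) (c : R) :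
  (\forall t \near (0 : R), is_derive t (1 : R) psi (dpsi t)) -> is_derive (0 : R) (1 : R) dpsi c ->
  (\forall t \near (0 : R), psi 0 <= psi t) -> dpsi 0 = 0 /\ 0 <= c.
Proof.
move=> H1 H2 H3.
have [e /= e0 He] : exists2 e : R, 0 < e & forall t, `|t| < e ->
    is_derive t (1 : R) psi (dpsi t) /\ psi 0 <= psi t.
  have /nbhs_ballP[e /= e0 He] : \forall t \near (0 : R),
    is_derive t (1 : R) psi (dpsi t) /\ psi 0 <= psi t by exact: filterI.
  by exists e => // t te; apply: He; rewrite /ball/= sub0r normrN.
have d0 : dpsi 0 = 0.
  have /(_ (- (e / 2)) (e / 2) 0) H := @derive1_at_min R psi.
  have [||||_ z0] := H.
  - by lra.
  - move=> t; rewrite in_itv/= => /andP[t1 t2].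
    by have [|[]//] := He t; rewrite ltr_norml; lra.
  - by rewrite in_itv/=; lra.
  - move=> t; rewrite in_itv/= => /andP[t1 t2].
    by have [|] := He t; rewrite ?ltr_norml //; lra.
  - by have [|[_ <-] _ //] := He 0; rewrite normr0.
split=> //; rewrite leNgt; apply/negP => c0.
have [d /= dd0 Hd] : exists2 d : R, 0 < d & forall t, 0 < t -> t < d -> dpsi t < 0.
  have [+ dc] := H2; move=> /cvg_ex[l hl].
  have lc : l = c by rewrite -dc; apply/esym/cvg_lim.
  rewrite lc in hl.
  have := cvgr_lt _ hl _ c0.
  move=> /(_ (dnbhs_filter _)); rewrite near_withinE => /nbhs_ballP[d /= dd Hd].
  exists d => // t t0 td; have := Hd t.
  rewrite /ball/= sub0r normrN gtr0_norm// => /(_ td (lt0r_neq0 t0)).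
  rewrite d0 subr0 addr0 (_ : t%:A = t); last exact: mulr1.
  by rewrite /GRing.scale/= pmulr_rlt0// invr_gt0.
pose t := Num.min e d / 2.
have t0 : 0 < t by rewrite divr_gt0// lt_min e0.
have [te td] : t < e /\ t < d.
  by have /andP[] : (t < e) && (t < d); rewrite // -lt_min ltr_pdivrMr// ltr_pMr ?ltr1n// lt_min e0.
have [||s sin] := @MVT R psi dpsi 0 t t0.
- move=> s; rewrite in_itv/= => /andP[s0 st].
  by have [] := He s; rewrite // gtr0_norm//; lra.
- apply: derivable_within_continuous => s; rewrite in_itv/= => /andP[s0 st].
  have sN : `|s| < e by rewrite ger0_norm//; lra.
  by have [[]] := He s sN.
rewrite subr0 => E; have [|_] := He t; first by rewrite gtr0_norm.
have := sin; rewrite in_itv/= => /andP[s0 st].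
rewrite -subr_ge0 E leNgt => /negP; apply.
by rewrite pmulr_llt0// Hd//; lra.
Qed.

(** The mean value theorem, applied once along [v] and once along [w], turns the mixed second
    difference over a square of side h into h^2 times a value of D_w D_v g inside the square. *)
Lemma schwarz_approx V (D : set V) (g : V -> R) x v w (e : R) :
  open D -> D x -> Ck_on 2 D g -> 0 < e ->
  exists2 d : R, 0 < d & forall h, 0 < h -> h < d ->
  `|(g (x + h *: v + h *: w) - g (x + h *: v) - (g (x + h *: w) - g x))
    - h ^+ 2 * hess g x w v| <= h ^+ 2 * e.
Proof.
move=> oD Dx [g1 g2] e0.
have [g2v /(_ w)/= g3] := g2 v.
have [r /= r0 Hr] : exists2 r : R, 0 < r & forall y, `|y| < r ->
    D (x + y) /\ `|'D_w ('D_v g) (x + y) - hess g x w v| <= e.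
  have := g3 x Dx => /cvgr_distC_le/(_ _ e0).
  move=> /(filterI (open_nbhs_nbhs (conj oD Dx)))/nbhs_ballP[r /= r0 Hr].
  exists r => // y yr; have [|//] := Hr (x + y).
  by rewrite -ball_normE/= opprD addrA subrr sub0r normrN.
(* A square of side h < r / N stays within distance r of [x]; the summand 1 keeps [N] positive when
   both directions vanish. *)
pose N := `|v| + `|w| + 1.
have N0 : 0 < N by rewrite /N ltr_wpDl// addr_ge0.
have box s t d : 0 <= s -> 0 <= t -> s <= d -> t <= d -> d < r / N ->
    `|s *: v + t *: w| < r.
  move=> s0 t0 sd td; rewrite ltr_pdivlMr// => dr.
  rewrite (le_lt_trans (ler_normD _ _))// !normrZ !ger0_norm//.
  have dd0 : 0 <= d by exact: le_trans sd.
  apply: le_lt_trans dr.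
  rewrite /N !mulrDr -[leLHS]addr0 lerD ?lerD ?ler_wpM2r// mulr1//.
exists (r / N); first exact: divr_gt0.
move=> h h0 hd.
have box' s t : 0 <= s -> 0 <= t -> s <= h -> t <= h ->
    D (x + s *: v + t *: w) /\ `|'D_w ('D_v g) (x + s *: v + t *: w) - hess g x w v| <= e.
  by move=> *; rewrite -addrA; apply: Hr; exact: (@box _ _ h).
have d1 s t : 0 <= s -> 0 <= t -> s <= h -> t <= h ->
    is_derive s 1 (fun s => g (x + t *: w + s *: v)) ('D_v g (x + t *: w + s *: v)).
  move=> s0 t0 sh th; apply: is_derive_line; apply: g1; rewrite addrAC.
  by have [] := box' s t s0 t0 sh th.
pose phi s := g (x + h *: w + s *: v) - g (x + 0 *: w + s *: v).
pose dphi s := 'D_v g (x + h *: w + s *: v) - 'D_v g (x + 0 *: w + s *: v).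
have dp s : 0 <= s -> s <= h -> is_derive s 1 phi (dphi s).
  by move=> s0 sh; apply: is_deriveB; apply: d1 => //; exact: ltW.
have [||s + E1] := @MVT R phi dphi 0 h h0.
- by move=> s; rewrite in_itv/= => /andP[s0 st]; apply: dp; exact: ltW.
- apply: derivable_within_continuous => s; rewrite in_itv/= => /andP[s0 st].
  by have [] := dp s s0 st.
rewrite in_itv/= => /andP[s0 sh].
have dl t : 0 <= t -> t <= h -> is_derive t 1 (fun t => 'D_v g (x + s *: v + t *: w))
    ('D_w ('D_v g) (x + s *: v + t *: w)).
  move=> t0 th; apply: is_derive_line; apply: g2v.
  by have [] := box' s t (ltW s0) t0 (ltW sh) th.
have [||t + E2] := @MVT R (fun t => 'D_v g (x + s *: v + t *: w))
    (fun t => 'D_w ('D_v g) (x + s *: v + t *: w)) 0 h h0.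
- by move=> t; rewrite in_itv/= => /andP[t0 th]; apply: dl; exact: ltW.
- apply: derivable_within_continuous => t; rewrite in_itv/= => /andP[t0 th].
  by have [] := dl t t0 th.
rewrite in_itv/= => /andP[t0 th].
have -> : g (x + h *: v + h *: w) - g (x + h *: v) - (g (x + h *: w) - g x) =
    phi h - phi 0.
  by rewrite /phi !scale0r !addr0 [x + h *: v + h *: w]addrAC.
rewrite E1 subr0 /dphi [x + h *: w + _]addrAC [x + 0 *: w + _]addrAC E2 subr0.
have -> : 'D_w ('D_v g) (x + s *: v + t *: w) * h * h - h ^+ 2 * hess g x w v =
  h ^+ 2 * ('D_w ('D_v g) (x + s *: v + t *: w) - hess g x w v) by ring.
rewrite normrM ger0_norm ?sqr_ge0// ler_pM2l ?exprn_gt0//.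
by have [] := box' s t (ltW s0) (ltW t0) (ltW sh) (ltW th).
Qed.

Lemma schwarz_scalar V (D : set V) (g : V -> R) x v w :
  open D -> D x -> Ck_on 2 D g -> hess g x v w = hess g x w v.
Proof.
move=> oD Dx Cg; apply/eqP; rewrite -subr_eq0 -normr_le0; apply/ler_addgt0Pl => e e0.
have e20 : 0 < e / 2 by rewrite divr_gt0.
have [d1 d10 H1] := schwarz_approx v w oD Dx Cg e20.
have [d2 d20 H2] := schwarz_approx w v oD Dx Cg e20.
pose h := Num.min d1 d2 / 2.
have h0 : 0 < h by rewrite divr_gt0// lt_min d10.
have /andP[hd1 hd2] : (h < d1) && (h < d2).
  by rewrite -lt_min ltr_pdivrMr// ltr_pMr ?ltr1n// lt_min d10.
(* The second difference does not change when [v] and [w] are exchanged, so both mixed derivatives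
   approximate the same number. *)
move: (H1 h h0 hd1) (H2 h h0 hd2); rewrite [x + h *: w + h *: v]addrAC.
have hh : 0 < h ^+ 2 by rewrite exprn_gt0.
move: (h ^+ 2) hh (hess _ _ _ _) (hess _ _ _ _) (g _) (g _) (g _) (g _) => k k0 b a c p q r.
rewrite addr0 => h1 h2; rewrite -(ler_pM2l k0) -[X in X * `|_|](ger0_norm (ltW k0)) -normrM.
have -> : k * (b - a) = (r - q - (p - c) - k * a) - (r - p - (q - c) - k * b) by ring.
rewrite (splitr e) mulrDr; apply: le_trans (ler_normB _ _) _.
exact: lerD.
Qed.

Lemma hessC V W (c : coords W) (D : set V) (g : V -> W) x v w :
  open D -> D x -> Ck_on 2 D g -> hess g x v w = hess g x w v.
Proof.
move=> oD Dx Cg; rewrite (coordsE c (hess g x v w)) (coordsE c (hess g x w v)).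
have E j u z : cfun c j (hess g x u z) = hess (cfun c j \o g) x u z.
  have [g1 g2] := Cg.
  rewrite /hess -derive_linear_comp; [|exact: cfun_continuous|by have [H _] := g2 z; exact: H].
  apply: near_eq_derive; apply: near_open oD Dx _ => y Dy.
  by rewrite derive_linear_comp//; [exact: cfun_continuous|exact: g1].
apply: eq_bigr => j _; rewrite !E (schwarz_scalar v w oD Dx)//.
by apply: Ck_on_linear_comp => //; exact: cfun_continuous.
Qed.

End Schwarz.

(** * A penalised minimisation problem *)

Section Dot.
Context {R : realType}.

(** The norm of the row vector spaces is the maximum norm, which is not differentiable; distances to
    be differentiated are Euclidean and expressed through [dot]. *)
Definition dot k (x y : 'rV[R]_k) : R := \sum_i x 0 i * y 0 i.

Lemma dotC k (x y : 'rV[R]_k) : dot x y = dot y x.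
Proof. by apply: eq_bigr => i _; rewrite mulrC. Qed.

Lemma dot_is_linear k (x : 'rV[R]_k) : linear (dot x).
Proof.
move=> a y z; rewrite /dot /GRing.scale/= mulr_sumr -big_split/=.
by apply: eq_bigr => i _; rewrite !mxE; ring.
Qed.
HB.instance Definition _ k (x : 'rV[R]_k) :=
  GRing.isLinear.Build R 'rV[R]_k R _ (dot x) (dot_is_linear x).

Lemma dotDl k (x y z : 'rV[R]_k) : dot (x + y) z = dot x z + dot y z.
Proof. by rewrite dotC linearD/= !(dotC z). Qed.

Lemma dotZl k a (x z : 'rV[R]_k) : dot (a *: x) z = a * dot x z.
Proof. by rewrite dotC linearZ/= dotC. Qed.

Lemma dotZr k a (x z : 'rV[R]_k) : dot x (a *: z) = a * dot x z.
Proof. by rewrite linearZ. Qed.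

Lemma dot_ge0 k (x : 'rV[R]_k) : 0 <= dot x x.
Proof. by apply: sumr_ge0 => i _; rewrite -expr2 sqr_ge0. Qed.

Lemma dot_eq0 k (x : 'rV[R]_k) : dot x x = 0 -> x = 0.
Proof.
move=> /eqP; rewrite psumr_eq0; last by move=> i _; rewrite -expr2 sqr_ge0.
move=> /allP H; apply/rowP => i; rewrite mxE; apply/eqP.
by have := H i (mem_index_enum _); rewrite mulf_eq0 orbb.
Qed.

Lemma dot_lt_norm k (x : 'rV[R]_k) e : 0 < e -> dot x x < e ^+ 2 -> `|x| < e.
Proof.
move=> e0 H; rewrite [ltLHS]/Num.Def.normr/= mx_normrE; apply/bigmax_ltP; split => // -[i j] _ /=.
rewrite -(@ltr_pXn2r _ 2) ?nnegrE//; last exact: ltW.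
rewrite real_normK ?num_real//; apply: le_lt_trans H; rewrite (ord1 i) /dot (bigD1 j)//= expr2 lerDl.
by apply: sumr_ge0 => l _; rewrite -expr2 sqr_ge0.
Qed.

Lemma bigsum_continuous_at (T : topologicalType) (W : normedModType R) (I : finType)
    (h : I -> T -> W) x :
  (forall i, {for x, continuous (h i)}) ->
  {for x, continuous (fun y => \sum_i h i y)}.
Proof.
move=> H; have -> : (fun y => \sum_i h i y) = \sum_i h i.
  by apply/funext => y; rewrite fct_sumE.
by elim/big_ind : _ => [|f g fc gc|//]; [exact: cvg_cst|exact: cvgD].
Qed.

Lemma cst_continuous_at (T T' : topologicalType) (a : T') (x : T) :
  {for x, continuous (fun=> a)}.
Proof. exact: cvg_cst. Qed.

Lemma id_continuous_at (T : topologicalType) (x : T) : {for x, continuous (fun y => y)}.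
Proof. exact: cvg_id. Qed.

Lemma sub_continuous_at (T : topologicalType) (W : normedModType R) (f g : T -> W) x :
  {for x, continuous f} -> {for x, continuous g} ->
  {for x, continuous (fun y => f y - g y)}.
Proof. exact: cvgB. Qed.

Lemma add_continuous_at (T : topologicalType) (W : normedModType R) (f g : T -> W) x :
  {for x, continuous f} -> {for x, continuous g} ->
  {for x, continuous (fun y => f y + g y)}.
Proof. exact: cvgD. Qed.

Lemma mul_continuous_at (T : topologicalType) (f g : T -> R) x :
  {for x, continuous f} -> {for x, continuous g} ->
  {for x, continuous (fun y => f y * g y)}.
Proof. exact: cvgM. Qed.

Lemma scale_continuous_at (T : topologicalType) (W : normedModType R) (f : T -> R) (g : T -> W) x :
  {for x, continuous f} -> {for x, continuous g} ->
  {for x, continuous (fun y => f y *: g y)}.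
Proof. exact: cvgZ. Qed.

Lemma dot_continuous_at (T : topologicalType) k (f g : T -> 'rV[R]_k) x :
  {for x, continuous f} -> {for x, continuous g} ->
  {for x, continuous (fun y => dot (f y) (g y))}.
Proof.
move=> fc gc; apply: bigsum_continuous_at => i; apply: cvgM.
  by apply: (@continuous_comp _ _ _ f (fun y : 'rV[R]_k => y 0 i)) => //; exact: coord_continuous.
by apply: (@continuous_comp _ _ _ g (fun y : 'rV[R]_k => y 0 i)) => //; exact: coord_continuous.
Qed.

Lemma is_derive_dot k (f g df dg : R -> 'rV[R]_k) (t : R) :
  (forall i, is_derive t (1 : R) (fun s => f s 0 i) (df t 0 i)) ->
  (forall i, is_derive t (1 : R) (fun s => g s 0 i) (dg t 0 i)) ->
  is_derive t (1 : R) (fun s => dot (f s) (g s)) (dot (f t) (dg t) + dot (df t) (g t)).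
Proof.
move=> Hf Hg.
have -> : (fun s => dot (f s) (g s)) =
    \sum_(i < k) ((fun s => f s 0 i) * (fun s => g s 0 i)).
  by apply/funext => s; rewrite fct_sumE.
apply: is_derive_eq; rewrite /dot -big_split/=; apply: eq_bigr => i _.
by rewrite /GRing.scale/=; ring.
Qed.

Lemma is_derive_line_coord p k (F : 'rV[R]_p -> 'rV[R]_k) c w (t : R) i :
  differentiable F (c + t *: w) ->
  is_derive t (1 : R) (fun s => F (c + s *: w) 0 i) ('D_w F (c + t *: w) 0 i).
Proof.
move=> dF; have dcF : differentiable (coord_rV i \o F) (c + t *: w).
  apply: differentiable_comp => //; apply: linear_differentiable.
  exact: coord_rV_continuous.
have := is_derive_line dcF.
by rewrite derive_linear_comp//; exact: coord_rV_continuous.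
Qed.

End Dot.

Section Penalty.
Context {R : realType}.

(* [t |-> |F (c + t w) - y|^2 - (d - b t - g t^2)^2] has a local minimum at 0:
   these are its first and second derivatives there. *)
Lemma penalty_line_min p k (F : 'rV[R]_p -> 'rV[R]_k) (D : set 'rV[R]_p) c w y (d b g : R) :
  open D -> D c -> Ck_on 2 D F -> dot (F c - y) (F c - y) = d ^+ 2 ->
  (\forall t \near (0 : R), (d - b * t - g * t ^+ 2) ^+ 2 <=
      dot (F (c + t *: w) - y) (F (c + t *: w) - y)) ->
  dot (F c - y) ('D_w F c) = - (d * b) /\
  0 <= dot (F c - y) (hess F c w w) + dot ('D_w F c) ('D_w F c) - b ^+ 2 + 2 * d * g.
Proof.
move=> oD Dc [F1 F2] Ed Hmin.
pose G t := F (c + t *: w) - y.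
pose dG t := 'D_w F (c + t *: w).
pose q (t : R) := d - b * t - g * t ^+ 2.
pose dq (t : R) := - b - 2 * g * t.
pose psi t := dot (G t) (G t) - q t ^+ 2.
pose dpsi t := 2 * dot (G t) (dG t) - 2 * (q t * dq t).
have cl : {for (0 : R), continuous (fun t : R => c + t *: w)}.
  by apply: add_continuous_at; [exact: cst_continuous_at|exact: scalel_continuous].
have Dnear : \forall t \near (0 : R), D (c + t *: w).
  by apply: cl; rewrite scale0r addr0; exact: open_nbhs_nbhs.
have dGt t i : D (c + t *: w) -> is_derive t (1 : R) (fun s => G s 0 i) (dG t 0 i).
  move=> Dt; have := @is_derive_line_coord _ _ _ F c w t i (F1 _ Dt) => H.
  have -> : (fun s => G s 0 i) = (fun s => F (c + s *: w) 0 i) - cst (y 0 i).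
    by apply/funext => s; rewrite /G !mxE.
  by apply: is_derive_eq; rewrite subr0.
have qt t : is_derive t (1 : R) q (dq t).
  rewrite (_ : q = cst d - b *: id - g *: (id ^+ 2)); last first.
    by apply/funext.
  apply: is_derive_eq.
  by rewrite /dq /GRing.scale/=; ring.
have dqt t : is_derive t (1 : R) dq (- 2 * g).
  rewrite (_ : dq = cst (- b) - (2 * g) *: id); last by apply/funext.
  by apply: is_derive_eq; rewrite /GRing.scale/=; ring.
have H1 : \forall t \near (0 : R), is_derive t (1 : R) psi (dpsi t).
  near=> t; have Dt : D (c + t *: w) by near: t.
  have := @is_derive_dot _ _ _ _ _ _ _ (fun i => dGt t i Dt) (fun i => dGt t i Dt) => H.
  rewrite (_ : psi = (fun s => dot (G s) (G s)) - q * q); last first.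
    by apply/funext => s; rewrite /psi expr2.
  have qtt := qt t.
  by apply: is_derive_eq; rewrite /dpsi /GRing.scale/= [dot (dG t) _]dotC; ring.
have Dc0 : D (c + 0 *: w) by rewrite scale0r addr0.
have H2 : is_derive (0 : R) (1 : R) dpsi (2 * (dot (G 0) (hess F c w w) +
    dot (dG 0) (dG 0)) - 2 * (b ^+ 2 - 2 * d * g)).
  have Hd i : is_derive (0 : R) (1 : R) (fun s => dG s 0 i) (hess F (c + 0 *: w) w w 0 i).
    by apply: is_derive_line_coord; have [+ _] := F2 w; exact.
  have := @is_derive_dot _ _ G dG dG (fun t => hess F (c + t *: w) w w) 0 (fun i => dGt 0 i Dc0) Hd => H.
  rewrite (_ : dpsi = 2 *: (fun s => dot (G s) (dG s)) - 2 *: (q * dq)); last first.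
    by apply/funext.
  have q0 := qt 0; have dq0 := dqt 0.
  apply: is_derive_eq; rewrite scale0r addr0 /q /dq /GRing.scale/=; ring.
have H3 : \forall t \near (0 : R), psi 0 <= psi t.
  have -> : psi 0 = 0.
    by rewrite /psi /G /q scale0r addr0 Ed mulr0 expr0n/= mulr0 !subr0 subrr.
  by move: Hmin; apply: filterS => t; rewrite subr_ge0.
have [] := second_order_min H1 H2 H3.
rewrite /dpsi /G /dG /q /dq scale0r addr0 => E1 E2; split; lra.
Unshelve. all: by end_near. Qed.

(** The covector [lam] is the gradient of the Euclidean norm at F a - y, which exists because [y] is
    not attained. The penalty keeps the minimiser off the boundary of the ball, so it may be varied
    in every direction. *)
Lemma penalised_critical_point p k (F : 'rV[R]_p -> 'rV[R]_k) (D : set 'rV[R]_p) r e :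
  open D -> Ck_on 2 D F -> 0 < r -> (forall a, `|a| <= r -> D a) ->
  ~ nbhs (F 0) (F @` [set a | `|a| <= r]) -> 0 < e ->
  exists lam a rho, [/\ dot lam lam = 1, `|a| < e, 0 <= rho < e,
   forall w, dot lam ('D_w F a) = - (2 * rho * dot a w) &
   forall w, 'D_w F a = dot lam ('D_w F a) *: lam ->
     0 <= dot lam (hess F a w w) + 2 * rho * dot w w].
Proof.
move=> oD CF r0 rD nF e0.
pose rho := e / 2; have rho0 : 0 < rho by rewrite divr_gt0.
pose s := Num.min e r; have s0 : 0 < s by rewrite lt_min e0.
(* The penalised value at 0 is |F 0 - y| < del = rho s^2, so a minimiser c satisfies rho |c|^2 < rho
   s^2. With s = min(e, r) this makes c both e-small and interior to the ball of radius r. *)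
pose del := rho * s ^+ 2; have del0 : 0 < del by rewrite mulr_gt0// exprn_gt0.
have [y yd yF] : exists2 y, dot (F 0 - y) (F 0 - y) < del ^+ 2 &
    ~ (F @` [set a | `|a| <= r]) y.
  apply: contra_notP nF => H.
  have : {for F 0, continuous (fun y : 'rV[R]_k => dot (F 0 - y) (F 0 - y))}.
    by apply: dot_continuous_at; apply: sub_continuous_at; (exact: cst_continuous_at || exact: id_continuous_at).
  rewrite /prop_for /continuous_at subrr [dot 0 0]linear0 => cc.
  have : \forall y \near F 0, dot (F 0 - y) (F 0 - y) < del ^+ 2.
    by apply: (cvgr_lt _ cc); exact: exprn_gt0.
  apply: filterS => y yd.
  by apply: contra_notP H => yF; exists y.
pose phi a := Num.sqrt (dot (F a - y) (F a - y)) + rho * dot a a.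
have Fc a : D a -> {for a, continuous F}.
  by move=> Da; apply: differentiable_continuous; have [H _] := CF; exact: H.
pose A := [set a : 'rV[R]_p | `|a| <= r].
have phic : {within A, continuous phi}.
  apply: continuous_in_subspaceT => a; rewrite inE => Aa.
  have Fa : {for a, continuous F} by apply: Fc; exact: rD.
  suff H : {for a, continuous (fun a : 'rV[R]_p => Num.sqrt (dot (F a - y) (F a - y)) + rho * dot a a)} by exact: H.
  apply: add_continuous_at.
    apply: (@continuous_comp _ _ _ (fun a => dot (F a - y) (F a - y)) Num.sqrt).
      by apply: dot_continuous_at; apply: sub_continuous_at; (exact: cst_continuous_at || exact: Fa).
    exact: sqrt_continuous.
  by apply: mul_continuous_at; [exact: cst_continuous_at|apply: dot_continuous_at; exact: id_continuous_at].
have Ac : compact A.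
  apply: bounded_closed_compact.
    by exists r; split; [exact: num_real|move=> M rM a Aa; exact: le_trans Aa (ltW rM)].
  rewrite (_ : A = (fun a : 'rV[R]_p => `|a|) @^-1` [set x | x <= r]); last by [].
  by apply: closed_comp => [a _|]; [exact: norm_continuous|exact: closed_le].
have A0 : A 0 by rewrite /A/= normr0 ltW.
have [c + cmin] := EVT_min_rV (ex_intro _ _ A0) Ac phic.
rewrite inE => Acr.
have Dc := rD _ Acr.
set d := Num.sqrt (dot (F c - y) (F c - y)).
have dE : dot (F c - y) (F c - y) = d ^+ 2 by rewrite sqr_sqrtr// dot_ge0.
have d0 : 0 < d.
  rewrite lt_neqAle sqrtr_ge0 andbT eq_sym; apply/eqP => dd0.
  apply: yF; exists c => //; apply/eqP; rewrite -subr_eq0; apply/eqP/dot_eq0.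
  by rewrite dE dd0 expr0n.
have cs : `|c| < s.
  apply: dot_lt_norm => //; have := cmin 0; rewrite inE => /(_ A0).
  rewrite /phi -/d [dot 0 0]linear0 mulr0 addr0 => H.
  rewrite -(ltr_pM2l rho0) -/del; apply: lt_le_trans (_ : d + rho * dot c c <= _).
    by rewrite ltrDr.
  by apply: le_trans H _; rewrite -(ger0_norm (ltW del0)) -sqrtr_sqr ler_wsqrtr// ltW.
have line w : dot (F c - y) ('D_w F c) = - (d * (2 * rho * dot c w)) /\
  0 <= dot (F c - y) (hess F c w w) + dot ('D_w F c) ('D_w F c) -
    (2 * rho * dot c w) ^+ 2 + 2 * d * (rho * dot w w).
  apply: (penalty_line_min oD Dc CF dE).
  have cl : {for (0 : R), continuous (fun t : R => c + t *: w)}.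
    by apply: add_continuous_at; [exact: cst_continuous_at|exact: scalel_continuous].
  have nA : \forall t \near (0 : R), `|c + t *: w| < r.
    have c0r : `|c + 0 *: w| < r by rewrite scale0r addr0 (lt_le_trans cs)// ge_min lexx orbT.
    have cn : {for (0 : R), continuous (fun t : R => `|c + t *: w|)}.
      exact: (@continuous_comp _ _ _ (fun t : R => c + t *: w) Num.norm _ cl (@norm_continuous _ _ _)).
    exact: (cvgr_lt _ cn).
  (* Moving the penalty terms to the other side, minimality at c along the line reads q t <= |F (c +
     t w) - y|. Since q 0 = d > 0, both sides may be squared near 0, which removes the square
     root. *)
  pose q (t : R) := d - 2 * rho * dot c w * t - rho * dot w w * t ^+ 2.
  have nq : \forall t \near (0 : R), 0 < q t.
    have q00 : 0 < q 0 by rewrite /q mulr0 expr0n/= mulr0 !subr0.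
    have cq : {for (0 : R), continuous q}.
      suff H : {for (0 : R), continuous (fun t => d - 2 * rho * dot c w * t - rho * dot w w * t ^+ 2)} by exact: H.
      apply: sub_continuous_at; first apply: sub_continuous_at.
      - exact: cst_continuous_at.
      - by apply: mul_continuous_at; [exact: cst_continuous_at|exact: id_continuous_at].
      - by apply: mul_continuous_at; [exact: cst_continuous_at|exact: exprn_continuous].
    exact: (cvgr_gt _ cq).
  near=> t.
  have q0 : 0 < q t by near: t.
  have At : A (c + t *: w) by apply: ltW; near: t.
  have := cmin (c + t *: w); rewrite inE => /(_ At); rewrite /phi -/d.
  have -> : dot (c + t *: w) (c + t *: w) = dot c c + 2 * t * dot c w + t ^+ 2 * dot w w.
    by rewrite dotDl !linearD/= !dotZl !dotZr [dot w c]dotC; ring.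
  move=> H.
  have {H} : q t <= Num.sqrt (dot (F (c + t *: w) - y) (F (c + t *: w) - y)).
    by rewrite /q; lra.
  rewrite -(@ler_pXn2r _ 2) ?nnegrE ?sqrtr_ge0//; last exact: ltW.
  by rewrite sqr_sqrtr// dot_ge0.
exists (d^-1 *: (F c - y)), c, rho.
have lamE w : dot (d^-1 *: (F c - y)) ('D_w F c) = - (2 * rho * dot c w).
  rewrite dotZl; have [-> _] := line w.
  by rewrite mulrN mulKf// gt_eqF.
split => //.
- by rewrite dotZl dotZr dE; field; rewrite gt_eqF.
- by rewrite (lt_le_trans cs)// ge_min lexx.
- by rewrite (ltW rho0)/= ltr_pdivrMr// ltr_pMr// ltr1n.
move=> w; rewrite lamE => DE; have [_] := line w.
(* For DF(c) w parallel to the unit vector [lam], the term |DF(c) w|^2 cancels against the square of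
   the first order coefficient; what is left is divisible by d. *)
have -> : dot ('D_w F c) ('D_w F c) = (2 * rho * dot c w) ^+ 2.
  by rewrite DE !dotZl !dotZr dE; field; rewrite gt_eqF.
rewrite addrK dotZl.
rewrite (_ : _ + _ = d * (d^-1 * dot (F c - y) (hess F c w w) + 2 * rho * dot w w)).
  by rewrite pmulr_rge0.
by field; rewrite gt_eqF.
Unshelve. all: by end_near. Qed.

End Penalty.

(** * Passing to the limit by compactness *)

Section Limits.
Context {R : realType}.

(** A cluster point without sequences: if every x in K had a radius below which [P] fails around it,
    compactness in its near-covering form, along the filter of small positive reals, would give one
    e for which [P] fails on all of K. Monotonicity in e makes the local failures comparable. *)
Lemma compact_limit_point (V : normedModType R) (K : set V) (P : R -> V -> Prop) :
  compact K -> (forall e e' x, e <= e' -> P e x -> P e' x) ->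
  (forall e, 0 < e -> exists2 x, K x & P e x) ->
  exists2 x, K x & forall e, 0 < e -> exists2 x', `|x - x'| < e & P e x'.
Proof.
move=> /compact_near_coveringP Kc Pm Pex; apply: contrapT => H.
have := Kc R (0 : R)^'+ (fun e x => ~ P e x) _.
case=> [x Kx|e /= e0 He].
  have [e e0 He] : exists2 e, 0 < e & forall x', `|x - x'| < e -> ~ P e x'.
    apply: contra_notP H => H; exists x => // e e0.
    apply: contra_notP H => H; exists e => // x' xx' Pe.
    by apply: H; exists x'.
  exists (ball x e, [set t | 0 < t < e]) => /=.
    split; first exact: nbhsx_ballx.
    near=> t; apply/andP; split; near: t; [exact: nbhs_right_gt|exact: nbhs_right_lt].
  move=> [x' t] /=; rewrite -ball_normE/= => -[xx' /andP[t0 te]] Pt.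
  by apply: (He x' xx'); apply: Pm Pt; exact: ltW.
have e20 : 0 < e / 2 by rewrite divr_gt0.
have [x Kx Px] := Pex _ e20.
apply: (He (e / 2) _ _ _ Kx Px) => //=.
by rewrite sub0r normrN gtr0_norm// ltr_pdivrMr// ltr_pMr// ltr1n.
Unshelve. all: by end_near. Qed.

(** The form in which equations and weak inequalities pass to the limit: [T] collects all converging
    parameters in one product, and [Z] is a point or a closed half-line. *)
Lemma closed_approx (T : pseudoMetricType R) (W : topologicalType) (f : T -> W)
    (Z : set W) x :
  closed Z -> {for x, continuous f} ->
  (forall e, 0 < e -> exists2 x', ball x e x' & Z (f x')) -> Z (f x).
Proof.
move=> cZ fc H; rewrite (closure_id Z).1// => B /fc/nbhs_ballP[e /= e0 eB].
by have [x' /eB Bx' Zx'] := H _ e0; exists (f x').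
Qed.

(** [Ck_on] gives continuity for fixed directions; expanding the direction in coordinates gives
    joint continuity in base point and direction. *)
Lemma derive_continuous_at (T : topologicalType) (V W : normedModType R) (c : coords V)
    (D : set V) (F : V -> W) (a w : T -> V) x :
  open D -> D (a x) -> Ck_on 1 D F -> {for x, continuous a} ->
  {for x, continuous w} -> {for x, continuous (fun y => 'D_(w y) F (a y))}.
Proof.
move=> oD Dx [F1 F2] ac wc.
have Da : \forall y \near x, D (a y) by apply: ac; exact: open_nbhs_nbhs.
have H : {for x, continuous (fun y => \sum_j cfun c j (w y) *: 'D_(cvec c j) F (a y))}.
  apply: bigsum_continuous_at => j; apply: scale_continuous_at.
    exact: (@continuous_comp _ _ _ w (cfun c j) _ wc (@cfun_continuous _ _ _ _ _)).
  by apply: (@continuous_comp _ _ _ a ('D_(cvec c j) F) _ ac); exact: F2.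
rewrite /prop_for /continuous_at (diff_coords c); last exact: F1.
apply: cvg_trans H; apply: near_eq_cvg; move: Da; apply: filterS => y Day.
by rewrite -(diff_coords c)//; exact: F1.
Qed.

Lemma hess_continuous_at (T : topologicalType) (V W : normedModType R) (c : coords V)
    (D : set V) (F : V -> W) (a w : T -> V) x :
  open D -> D (a x) -> Ck_on 2 D F -> {for x, continuous a} ->
  {for x, continuous w} -> {for x, continuous (fun y => hess F (a y) (w y) (w y))}.
Proof.
move=> oD Dx CF ac wc; have [F1 F2] := CF.
have Da : \forall y \near x, D (a y) by apply: ac; exact: open_nbhs_nbhs.
(* Expanding only the inner direction suffices: the outer one is handled by [derive_continuous_at],
   applied to the C^1 maps ['D_(cvec c j) F]. *)
have E z v : D z -> hess F z v v = \sum_j cfun c j v *: 'D_v ('D_(cvec c j) F) z.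
  move=> Dz; pose hL : {linear V -> W} := HB.pack (hess F z v)
    (GRing.isLinear.Build R V W _ _ (hess_linearr v oD CF Dz)).
  rewrite -[LHS]/(hL v) {1}(coordsE c v) linear_sum.
  by apply: eq_bigr => j _; rewrite linearZ.
have H : {for x, continuous (fun y => \sum_j cfun c j (w y) *: 'D_(w y) ('D_(cvec c j) F) (a y))}.
  apply: bigsum_continuous_at => j; apply: scale_continuous_at.
    exact: (@continuous_comp _ _ _ w (cfun c j) _ wc (@cfun_continuous _ _ _ _ _)).
  have CDF : Ck_on 1 D ('D_(cvec c j) F) by exact: F2.
  exact: (derive_continuous_at c oD Dx CDF ac wc).
rewrite /prop_for /continuous_at E//.
apply: cvg_trans H; apply: near_eq_cvg; move: Da; apply: filterS => y Day.
by rewrite E.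
Qed.

Lemma continuous_linear_rV p (W : normedModType R) (l : {linear 'rV[R]_p -> W}) :
  continuous l.
Proof.
move=> x; have lE : (fun y => \sum_j coord_rV j y *: l (delta_mx 0 j)) = l :> ('rV[R]_p -> W).
  apply/funext => y; rewrite [in RHS](coordsE (coords_rV p) y) linear_sum.
  by apply: eq_bigr => j _; rewrite linearZ.
suff : {for x, continuous (fun y => \sum_j coord_rV j y *: l (delta_mx 0 j))}.
  by rewrite lE.
apply: bigsum_continuous_at => j; apply: scale_continuous_at; last exact: cst_continuous_at.
exact: coord_rV_continuous.
Qed.

Lemma dot_sphere_compact k : compact [set x : 'rV[R]_k | dot x x = 1].
Proof.
apply: bounded_closed_compact.
  exists 2; split; [exact: num_real|move=> M M2 x /= x1; apply: ltW].
  apply: lt_trans M2; apply: dot_lt_norm => //; rewrite x1; lra.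
rewrite (_ : [set _ | _] = (fun x => dot x x) @^-1` [set 1]); last by [].
apply: closed_comp => [x _|]; last exact: closed_eq.
by apply: dot_continuous_at; exact: id_continuous_at.
Qed.

End Limits.

(** * A second order necessary condition for not being open *)

Section Necessary.
Context {R : realType}.

(* Modulo the line spanned by [lam] the target has dimension k - 1. *)
Lemma exists_mapped_to_line p k (T : {linear 'rV[R]_p -> 'rV[R]_k}) (lam : 'rV[R]_k)
    (U : {vspace 'rV[R]_p}) : dot lam lam = 1 -> (k <= \dim U)%N ->
  exists w, [/\ w \in U, dot w w = 1 & T w = dot lam (T w) *: lam].
Proof.
move=> l1 kU.
have pl : linear (fun w => T w - dot lam (T w) *: lam).
  move=> a x y; rewrite !linearP/= scalerDl scalerBr opprD addrACA.
  by rewrite -[a *: dot _ _ *: _]scalerA.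
pose pL : {linear 'rV[R]_p -> 'rV[R]_k} := HB.pack (fun w => T w - dot lam (T w) *: lam)
  (GRing.isLinear.Build R _ _ _ _ pl).
pose f := linfun pL.
pose h : 'Hom('rV[R]_k, R^o) := linfun (dot lam : 'rV[R]_k -> R^o).
have hE x : h x = dot lam x by rewrite lfunE.
have fh : (f @: U <= lker h)%VS.
  apply/subvP => _ /memv_imgP[u uU ->]; rewrite memv_ker hE lfunE/=.
  by rewrite linearB/= dotZr l1 mulr1 subrr.
have dh : (\dim (lker h) < k)%N.
  have := limg_ker_dim h fullv; rewrite capfv dimvf /dim/= mul1n.
  suff : (0 < \dim (h @: fullv))%N by lia.
  rewrite lt0n dimv_eq0; apply/eqP => h0.
  have : h lam \in (h @: fullv)%VS by rewrite memv_img// memvf.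
  by rewrite h0 memv0 hE l1 oner_eq0.
have : (0 < \dim (U :&: lker f))%N.
  rewrite lt0n; apply/eqP => d0; move: kU.
  by rewrite -(limg_ker_dim f U) d0 add0n leqNgt (leq_ltn_trans (dimvS fh) dh).
rewrite lt0n dimv_eq0 -vpick0; set w := vpick _ => w0.
have : w \in (U :&: lker f)%VS by exact: memv_pick.
rewrite memv_cap memv_ker lfunE/= subr_eq0 => /andP[wU /eqP Tw].
have ww : 0 < dot w w.
  rewrite lt_neqAle dot_ge0 andbT eq_sym; apply/eqP => /dot_eq0 ww0.
  by rewrite ww0 eqxx in w0.
exists ((Num.sqrt (dot w w))^-1 *: w); split.
- exact: memvZ.
- rewrite dotZl dotZr mulrA -invfM -expr2 sqr_sqrtr ?dot_ge0// mulVf// gt_eqF//.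
- by rewrite linearZ/= dotZr -scalerA -Tw.
Qed.

(** The subspace [C], on which DF(0) is injective, encodes the rank: for a complement of the kernel
    its dimension is the rank of DF(0). Since DF(0) vanishes on [V], the two subspaces meet only in
    0. *)
Lemma second_order_necessary p k (F : 'rV[R]_p -> 'rV[R]_k) (D : set 'rV[R]_p) r :
  open D -> Ck_on 2 D F -> 0 < r -> (forall a, `|a| <= r -> D a) ->
  ~ nbhs (F 0) (F @` [set a | `|a| <= r]) ->
  exists lam, [/\ dot lam lam = 1, forall w, dot lam ('D_w F 0) = 0 &
   forall V C : {vspace 'rV[R]_p}, (forall w, w \in V -> 'D_w F 0 = 0) ->
     (forall w, w \in V -> w != 0 -> dot lam (hess F 0 w w) < 0) ->
     (forall w, w \in C -> 'D_w F 0 = 0 -> w = 0) ->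
     (\dim V + \dim C < k)%N].
Proof.
move=> oD CF r0 rD nF.
have D0 : D 0 by apply: rD; rewrite normr0 ltW.
pose P e (lam : 'rV[R]_k) := exists a rho, [/\ `|a| < e, 0 <= rho < e,
   forall w, dot lam ('D_w F a) = - (2 * rho * dot a w) &
   forall w, 'D_w F a = dot lam ('D_w F a) *: lam ->
     0 <= dot lam (hess F a w w) + 2 * rho * dot w w].
(* The condition [dot l l = 1] is repeated in the property because [compact_limit_point] does not
   say that the approximating points lie in the compact set. Membership in [U] is put into [Q] below
   for the same reason. *)
have [||lam l1 Hl] := @compact_limit_point R 'rV[R]_k [set x | dot x x = 1]
    (fun e l => dot l l = 1 /\ P e l) (@dot_sphere_compact R k).
- move=> e e' x ee' [x1 [a [rho [ae /andP[rho0 rhoe] H1 H2]]]]; split => //.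
  exists a, rho; split => //; first exact: lt_le_trans ee'.
  by rewrite rho0/=; exact: lt_le_trans ee'.
- move=> e e0.
  have [lam [a [rho [l1 ae re H1 H2]]]] := penalised_critical_point oD CF r0 rD nF e0.
  by exists lam => //; split => //; exists a, rho.
have CF1 : Ck_on 1 D F by exact: Ck_on_S.
have first w : dot lam ('D_w F 0) = 0.
  pose T := ('rV[R]_k * 'rV[R]_p * R)%type.
  pose f (x : T) := dot x.1.1 ('D_w F x.1.2) + 2 * x.2 * dot x.1.2 w.
  have -> : dot lam ('D_w F 0) = f (lam, 0, 0) by rewrite /f/= mulr0 mul0r addr0.
  have c1 (x : T) : {for x, continuous (fun x : T => x.1.1)}.
    by apply: (@continuous_comp _ _ _ (fst : T -> _) fst); exact: cvg_fst.
  have c2 (x : T) : {for x, continuous (fun x : T => x.1.2)}.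
    by apply: (@continuous_comp _ _ _ (fst : T -> _) snd); [exact: cvg_fst|exact: cvg_snd].
  have c3 (x : T) : {for x, continuous (fun x : T => x.2)} by exact: cvg_snd.
  apply: (@closed_approx R T R f [set 0] (lam, 0, 0)); first exact: closed_eq.
    pose x1 : T := (lam, 0, 0).
    have cD := @derive_continuous_at R T _ _ (coords_rV p) D F (fun x => x.1.2) (fun=> w) x1
      oD D0 CF1 (c2 x1) (@cst_continuous_at T 'rV[R]_p w x1).
    exact: (add_continuous_at (dot_continuous_at (c1 x1) cD)
      (mul_continuous_at (mul_continuous_at (@cst_continuous_at T R 2 x1) (c3 x1)) (dot_continuous_at (c2 x1) (@cst_continuous_at T 'rV[R]_p w x1)))).
  move=> e e0; have [l ll [_ [a [rho [ae /andP[rho0 rhoe] H1 _]]]]] := Hl e e0.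
  exists (l, a, rho); last by rewrite /f/= H1 addrC subrr.
  by split; [split|]; rewrite -ball_normE/= ?sub0r ?normrN// ger0_norm.
exists lam; split => // V C HV Vneg HC; rewrite ltnNge; apply/negP => kVC.
pose U := (V + C)%VS.
have VC0 : (V :&: C)%VS = 0%VS.
  apply/eqP; rewrite -subv0; apply/subvP => w; rewrite memv_cap memv0 => /andP[wV wC].
  by rewrite (HC w wC)//; exact: HV.
have kU : (k <= \dim U)%N by rewrite dimv_disjoint_sum.
pose Q e (w : 'rV[R]_p) := w \in U /\ exists a l rho, [/\ `|a| < e, `|lam - l| < e,
   0 <= rho < e, 'D_w F a = dot l ('D_w F a) *: l &
   0 <= dot l (hess F a w w) + 2 * rho * dot w w].
have [||w w1 Hw] := @compact_limit_point R 'rV[R]_p [set x | dot x x = 1]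
    Q (@dot_sphere_compact R p).
- move=> e e' x ee' [xU [a [l [rho [ae le /andP[rho0 rhoe] H1 H2]]]]]; split => //.
  exists a, l, rho; split => //; [exact: lt_le_trans ee'|exact: lt_le_trans ee'|].
  by rewrite rho0/=; exact: lt_le_trans ee'.
(* Staying below r keeps the nearby point a in [D], where DF(a) exists. *)
- move=> e e0; pose e1 := Num.min e r.
  have e10 : 0 < e1 by rewrite lt_min e0.
  have [l ll [ldot [a [rho [ae /andP[rho0 rhoe] _ H2]]]]] := Hl e1 e10.
  have Da : D a by apply: rD; apply/ltW/(lt_le_trans ae); rewrite ge_min lexx orbT.
  have dFa : differentiable F a by have [H _] := CF; exact: H.
  have [w [wU w1 Fw]] := @exists_mapped_to_line _ _ ('d F a) l U ldot kU.
  rewrite -deriveE// in Fw.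
  have e1e : e1 <= e by rewrite ge_min lexx.
  exists w => //; split => //; exists a, l, rho; split => //.
  + exact: lt_le_trans e1e.
  + exact: lt_le_trans e1e.
  + by rewrite rho0/=; exact: lt_le_trans e1e.
  + exact: H2.
(* A subspace is closed, being the zero set of w - [projv U w]. *)
have wU : w \in U.
  have pc : continuous (projv U : {linear 'rV[R]_p -> 'rV[R]_p}) by exact: continuous_linear_rV.
  suff /eqP : w - projv U w = 0 by rewrite subr_eq0 => /eqP ->; exact: memv_proj.
  apply: (@closed_approx R 'rV[R]_p 'rV[R]_p (fun w => w - projv U w) [set 0] w).
  - exact/accessible_closed_set1/hausdorff_accessible/norm_hausdorff.
  - by apply: sub_continuous_at; [exact: id_continuous_at|exact: pc].
  - move=> e e0; have [w' ww' [w'U _]] := Hw e e0; exists w'.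
      by rewrite -ball_normE.
    by rewrite /= projv_id// subrr.
pose T := ('rV[R]_k * 'rV[R]_p * (R * 'rV[R]_p))%type.
have c1 (x : T) : {for x, continuous (fun x : T => x.1.1)}.
  by apply: (@continuous_comp _ _ _ (fst : T -> _) fst); exact: cvg_fst.
have c2 (x : T) : {for x, continuous (fun x : T => x.1.2)}.
  by apply: (@continuous_comp _ _ _ (fst : T -> _) snd); [exact: cvg_fst|exact: cvg_snd].
have c3 (x : T) : {for x, continuous (fun x : T => x.2.1)}.
  by apply: (@continuous_comp _ _ _ (snd : T -> _) fst); [exact: cvg_snd|exact: cvg_fst].
have c4 (x : T) : {for x, continuous (fun x : T => x.2.2)}.
  by apply: (@continuous_comp _ _ _ (snd : T -> _) snd); exact: cvg_snd.
pose x0 : T := ((lam, 0), (0, w)).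
have approx e : 0 < e -> exists2 x : T, ball x0 e x &
    'D_(x.2.2) F x.1.2 = dot x.1.1 ('D_(x.2.2) F x.1.2) *: x.1.1 /\
    0 <= dot x.1.1 (hess F x.1.2 x.2.2 x.2.2) + 2 * x.2.1 * dot x.2.2 x.2.2.
  move=> e0; have [w' ww' [_ [a [l [rho [ae le /andP[rho0 rhoe] H1 H2]]]]]] := Hw e e0.
  exists ((l, a), (rho, w')) => //.
  by split; split; rewrite -ball_normE/= ?sub0r ?normrN// ger0_norm.
have cD : {for x0, continuous (fun x : T => 'D_(x.2.2) F x.1.2)}.
  exact: (@derive_continuous_at R T _ _ (coords_rV p) D F (fun x => x.1.2) (fun x => x.2.2) x0
    oD D0 CF1 (c2 x0) (c4 x0)).
(* In the limit DF(0) w is a multiple of [lam], while [lam] is orthogonal to the image of DF(0). *)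
have Fw : 'D_w F 0 = 0.
  pose f (x : T) := 'D_(x.2.2) F x.1.2 - dot x.1.1 ('D_(x.2.2) F x.1.2) *: x.1.1.
  have : f x0 = 0.
    apply: (@closed_approx R T 'rV[R]_k f [set 0] x0).
      exact/accessible_closed_set1/hausdorff_accessible/norm_hausdorff.
      exact: (sub_continuous_at cD (scale_continuous_at (dot_continuous_at (c1 x0) cD) (c1 x0))).
    move=> e /approx[x bx [Ex _]]; exists x => //.
    by rewrite /f/= {1}Ex subrr.
  by rewrite /f/= first scale0r subr0.
have second : 0 <= dot lam (hess F 0 w w).
  pose f (x : T) := dot x.1.1 (hess F x.1.2 x.2.2 x.2.2) + 2 * x.2.1 * dot x.2.2 x.2.2.
  have : 0 <= f x0.
    apply: (@closed_approx R T R f [set y | 0 <= y] x0); first exact: closed_ge.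
      have cH := @hess_continuous_at R T _ _ (coords_rV p) D F (fun x => x.1.2) (fun x => x.2.2)
        x0 oD D0 CF (c2 x0) (c4 x0).
      exact: (add_continuous_at (dot_continuous_at (c1 x0) cH)
        (mul_continuous_at (mul_continuous_at (@cst_continuous_at T R 2 x0) (c3 x0)) (dot_continuous_at (c4 x0) (c4 x0)))).
    by move=> e /approx[x bx [_ Ex]]; exists x.
  by rewrite /f/= mulr0 mul0r addr0.
have /memv_addP[v vV [c cC wvc]] := wU.
have dF0 : differentiable F 0 by have [H _] := CF; exact: H.
(* DF(0) kills both w and its component in [V], hence also the component in [C], on which it is
   injective. *)
have c0 : c = 0.
  apply: (HC c cC); have Dvc := derive_dir_linear 1 v c dF0.
  rewrite !scale1r in Dvc.
  by rewrite wvc Dvc (HV v vV) add0r in Fw.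
have wV : w \in V by rewrite wvc c0 addr0.
have w0 : w != 0.
  apply/eqP => w0; move: w1; rewrite /= w0 [dot 0 0]linear0 => /eqP.
  by rewrite eq_sym oner_eq0.
by have := Vneg w wV w0; rewrite ltNge second.
Qed.

End Necessary.

(** * Local representatives and pull-backs of vector fields *)

(* Sealed: unification otherwise unfolds the Jacobian matrix of the library. *)
HB.lock Definition Jac (R : realType) p k (F : 'rV[R]_p -> 'rV[R]_k)
  (x : 'rV[R]_p) : 'M[R]_(p, k) := 'J F x.

Section Jacobian.
Context {R : realType}.

Lemma eq_mulmxl p k (A B : 'M[R]_(p, k)) :
  (forall v : 'rV[R]_p, v *m A = v *m B) -> A = B.
Proof. by move=> H; apply/row_matrixP => i; rewrite !rowE. Qed.

Lemma JacE p k (F : 'rV[R]_p -> 'rV[R]_k) x : 'J F x = Jac F x.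
Proof. by rewrite Jac.unlock. Qed.

Lemma mulmx_jacobian p k (F : 'rV[R]_p -> 'rV[R]_k) x (v : 'rV[R]_p) :
  differentiable F x -> v *m Jac F x = 'D_v F x.
Proof. by move=> dF; rewrite deriveE// Jac.unlock /jacobian mul_rV_lin1. Qed.

Lemma jacobian_near p k (F G : 'rV[R]_p -> 'rV[R]_k) x :
  (\forall y \near x, F y = G y) -> differentiable F x -> Jac F x = Jac G x.
Proof.
move=> FG dF; have dG := near_eq_differentiable FG dF.
apply: eq_mulmxl => v; rewrite (mulmx_jacobian _ dF) (mulmx_jacobian _ dG).
exact: near_eq_derive.
Qed.

Lemma jacobian_comp p k l (F : 'rV[R]_p -> 'rV[R]_k) (G : 'rV[R]_k -> 'rV[R]_l) x :
  differentiable F x -> differentiable G (F x) ->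
  Jac (G \o F) x = Jac F x *m Jac G (F x).
Proof.
move=> dF dG; have dGF := differentiable_comp dF dG.
apply: eq_mulmxl => v; rewrite mulmxA (mulmx_jacobian _ dGF) (mulmx_jacobian _ dF).
by rewrite (mulmx_jacobian _ dG) (derive_comp _ dF dG).
Qed.

Lemma jacobian_id p x : Jac (id : 'rV[R]_p -> 'rV[R]_p) x = 1%:M.
Proof.
have di : differentiable (id : 'rV[R]_p -> 'rV[R]_p) x by [].
by apply: eq_mulmxl => v; rewrite mulmx1 mulmx_jacobian// derive_id.
Qed.

Lemma pair_continuous_at (T T1 T2 : topologicalType) (g : T -> T1) (h : T -> T2) x :
  {for x, continuous g} -> {for x, continuous h} ->
  {for x, continuous (fun y => (g y, h y))}.
Proof. exact: cvg_pair. Qed.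

Lemma near_preimage_open (T T' : topologicalType) (h : T -> T') (A : set T') x :
  {for x, continuous h} -> open A -> A (h x) -> \forall y \near x, A (h y).
Proof. by move=> hc oA Ax; apply: hc; exact: open_nbhs_nbhs. Qed.

End Jacobian.

Section Local.
Context {R : realType} {n m : nat} {M : topologicalType}.
Variable S : smooth_manifold R n M.
Variables (U : set 'rV[R]_m) (f : M -> 'rV[R]_m -> M).
Hypothesis f_C2 : has_Ck_extension S 2 U f.
Hypothesis f_diffeo : forall u, U u -> Ck_diffeo_onto_open S 2 (f^~ u).
Implicit Types phi psi theta : chart R n M.

Lemma interior_sub u : interior U u -> U u. Proof. exact: interior_subset. Qed.

Lemma f_continuous x u : interior U u -> {for (x, u), continuous (fun p => f p.1 p.2)}.
Proof.
have [V [g [oV UV [gc _] gf]]] := f_C2.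
move=> iu; have Uu := interior_sub iu.
have := gc x u (UV _ Uu); rewrite /prop_for /continuous_at/= gf// => H.
apply: cvg_trans H; apply: near_eq_cvg.
have : \forall p \near (x, u), interior U p.2.
  exact: (@near_preimage_open _ _ (snd : M * 'rV[R]_m -> _) _ (x, u) cvg_snd (@open_interior _ U) iu).
by apply: filterS => p /interior_sub Up; rewrite gf.
Qed.

Lemma f_continuousl x u : U u -> {for x, continuous (f^~ u)}.
Proof. by move=> /f_diffeo[_ [H _] _]; exact: H. Qed.

Lemma f_continuousr x u : interior U u -> {for u, continuous (f x)}.
Proof.
move=> iu; have H := f_continuous (x := x) iu.
have c : {for u, continuous (fun v => (x, v))}.
  by apply: pair_continuous_at; [exact: cst_continuous_at|exact: id_continuous_at].
exact: (@continuous_comp _ _ _ (fun v => (x, v)) (fun p => f p.1 p.2) _ c H).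
Qed.

(** With the interior of [U] the domain is open, and [f] coincides on it with its C^2 extension, so
    that derivatives of [f] itself make sense. *)
Definition step_dom phi psi : set ('rV[R]_n * 'rV[R]_m) :=
  [set p | [/\ cimg phi p.1, interior U p.2 & cdom psi (f (cinv phi p.1) p.2)]].
Definition step_coord phi psi (p : 'rV[R]_n * 'rV[R]_m) : 'rV[R]_n :=
  psi (f (cinv phi p.1) p.2).

Lemma step_dom_open phi psi : open (step_dom phi psi).
Proof.
rewrite openE => -[y u] [/= yphi iu fpsi].
have n1 : \forall p \near (y, u), cimg phi p.1.
  have H := (@near_preimage_open _ _ (fst : 'rV[R]_n * 'rV[R]_m -> _) _ (y, u) cvg_fst (@cimg_open _ _ _ phi)). exact: H yphi.
have n2 : \forall p \near (y, u), interior U p.2.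
  exact: (@near_preimage_open _ _ (snd : 'rV[R]_n * 'rV[R]_m -> _) _ _ cvg_snd (@open_interior _ U)).
have n3 : \forall p \near (y, u), cdom psi (f (cinv phi p.1) p.2).
  apply: (@near_preimage_open _ _ (fun p => f (cinv phi p.1) p.2)) => //; last exact: cdom_open.
  apply: (@continuous_comp _ _ _ (fun p : 'rV[R]_n * 'rV[R]_m => (cinv phi p.1, p.2)) (fun p => f p.1 p.2)).
    apply: pair_continuous_at; last exact: cvg_snd.
    apply: (@continuous_comp _ _ _ (fst : 'rV[R]_n * 'rV[R]_m -> _) (cinv phi)); first exact: cvg_fst.
    exact: cinv_continuous.
  exact: f_continuous.
by near=> p; split; near: p.
Unshelve. all: by end_near. Qed.

Lemma step_coord_Ck phi psi : atlas S phi -> atlas S psi ->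
  Ck_on 2 (step_dom phi psi) (step_coord phi psi).
Proof.
move=> aphi apsi; have [V [g [oV UV [gc gC] gf]]] := f_C2.
apply: (@Ck_on_ext _ _ _ _ _ (fun p => psi (g (cinv phi p.1) p.2))).
- exact: step_dom_open.
- by move=> p [_ /interior_sub Up _]; rewrite gf.
apply: Ck_on_sub (gC _ _ aphi apsi) => p [p1 /interior_sub p2 p3].
by split => //; [exact: UV|rewrite gf].
Qed.

Lemma trans_differentiable phi psi x : atlas S phi -> atlas S psi ->
  cdom phi x -> cdom psi x -> differentiable (psi \o cinv phi) (phi x).
Proof.
move=> aphi apsi xphi xpsi; have [H _] := atlas_compat aphi apsi 1.
by apply: H; split; [exact: cmap_cimg|rewrite /= cmapK].
Qed.

Lemma near_cdom phi psi y : cimg phi y -> cdom psi (cinv phi y) ->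
  \forall z \near y, cimg phi z /\ cdom psi (cinv phi z).
Proof.
move=> yphi ypsi; apply: filterI; first by apply: open_nbhs_nbhs; split => //; exact: cimg_open.
exact: (near_preimage_open (cinv_continuous yphi) (@cdom_open _ _ _ psi) ypsi).
Qed.

Lemma trans_comp phi psi theta x (k : nat) (F : 'rV[R]_n -> 'rV[R]_k) :
  atlas S phi -> atlas S psi -> cdom phi x -> cdom psi x ->
  differentiable F (psi x) ->
  Jac (fun y => F (psi (cinv phi y))) (phi x) = Jac (psi \o cinv phi) (phi x) *m Jac F (psi x).
Proof.
move=> aphi apsi xphi xpsi dF.
have := @jacobian_comp _ _ _ _ (psi \o cinv phi) F (phi x) (trans_differentiable aphi apsi xphi xpsi).
by rewrite /= cmapK// => ->.
Qed.

Lemma fu_differentiable phi psi u x : atlas S phi -> atlas S psi -> U u ->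
  cdom phi x -> cdom psi (f x u) ->
  differentiable (fun y => psi (f (cinv phi y) u)) (phi x).
Proof.
move=> aphi apsi Uu xphi fpsi; have [_ [_ H] _] := f_diffeo Uu.
by have [+ _] := H _ _ aphi apsi; apply; split; rewrite ?cmapK//; exact: cmap_cimg.
Qed.

Lemma near_fu phi psi u x : U u -> cdom phi x -> cdom psi (f x u) ->
  \forall y \near phi x, cimg phi y /\ cdom psi (f (cinv phi y) u).
Proof.
move=> Uu xphi fpsi; apply: filterI.
  by apply: open_nbhs_nbhs; split; [exact: cimg_open|exact: cmap_cimg].
apply: (@near_preimage_open _ _ (fun y => f (cinv phi y) u)); last 2 first.
- exact: cdom_open.
- by rewrite cmapK.
apply: (@continuous_comp _ _ _ (cinv phi) (f^~ u)).
  by apply: cinv_continuous; exact: cmap_cimg.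
exact: f_continuousl.
Qed.

(** The inverse of f_u is differentiable in charts, and the chain rule for the identity exhibits an
    inverse matrix. *)
Lemma fu_jacobian_unit phi psi u x : atlas S phi -> atlas S psi -> U u ->
  cdom phi x -> cdom psi (f x u) ->
  Jac (fun y => psi (f (cinv phi y) u)) (phi x) \in unitmx.
Proof.
move=> aphi apsi Uu xphi fpsi; have [_ _ [h [fK [hc hC]]]] := f_diffeo Uu.
have df := fu_differentiable aphi apsi Uu xphi fpsi.
pose B := fun z => phi (h (cinv psi z)).
have dB : differentiable B (psi (f (cinv phi (phi x)) u)).
  have [+ _] := hC _ _ apsi aphi; apply.
  rewrite /= cmapK// cmapK//; split; first exact: cmap_cimg.
    by exists x.
  by rewrite fK.
have JJ := jacobian_comp df dB.
suff H : Jac (B \o (fun y => psi (f (cinv phi y) u))) (phi x) = 1%:M.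
  by move: JJ; rewrite H => /esym/mulmx1_unit[].
rewrite -(jacobian_id (phi x)); apply: jacobian_near; last exact: differentiable_comp.
have := near_fu Uu xphi fpsi; apply: filterS => y [yphi ypsi].
by rewrite /B/= cmapK// fK cinvK.
Qed.

Lemma fur_differentiable psi u x : atlas S psi -> interior U u ->
  cdom psi (f x u) -> differentiable (fun v => psi (f x v)) u.
Proof.
move=> apsi iu fpsi; pose phi := chart_at S x.
have aphi : atlas S phi by exact: chart_at_atlas.
have xphi : cdom phi x by exact: chart_at_cdom.
have -> : (fun v => psi (f x v)) = step_coord phi psi \o (fun v => (phi x, v)).
  by apply/funext => v; rewrite /step_coord/= cmapK.
apply: differentiable_comp; first exact: differentiable_pair.
have [H _] := step_coord_Ck aphi apsi; apply: H.
by split; rewrite /= ?cmapK//; exact: cmap_cimg.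
Qed.

Local Notation c_ x := (chart_at S x).

Lemma vf_coordE phi X x : atlas S phi -> cdom phi x ->
  vf_coord S phi X (phi x) = X x *m Jac (phi \o cinv (c_ x)) (c_ x x).
Proof. by move=> aphi xphi; rewrite /vf_coord cmapK// JacE. Qed.

Lemma vf_coord_chart_at X x : vf_coord S (c_ x) X (c_ x x) = X x.
Proof.
rewrite vf_coordE; [|exact: chart_at_atlas|exact: chart_at_cdom].
rewrite (@jacobian_near _ _ _ _ id); first by rewrite jacobian_id mulmx1.
  have : \forall y \near c_ x x, cimg (c_ x) y.
    by apply: open_nbhs_nbhs; split; [exact: cimg_open|exact/cmap_cimg/chart_at_cdom].
  by apply: filterS => y yc; rewrite /= cinvK.
by apply: trans_differentiable; (exact: chart_at_atlas || exact: chart_at_cdom).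
Qed.

(** [dmap] uses the chart chosen at each point, which need not depend continuously on the point.
    This lemma and the next move the target and the source to fixed charts. *)
Lemma fu_change u x theta phi : U u -> atlas S phi -> atlas S theta -> cdom phi x ->
  cdom theta (f x u) ->
  Jac (fun y => theta (f (cinv phi y) u)) (phi x) =
  Jac (fun y => c_ (f x u) (f (cinv phi y) u)) (phi x) *m
  Jac (theta \o cinv (c_ (f x u))) (c_ (f x u) (f x u)).
Proof.
move=> Uu aphi atheta xphi ftheta.
have ac : atlas S (c_ (f x u)) by exact: chart_at_atlas.
have fc : cdom (c_ (f x u)) (f x u) by exact: chart_at_cdom.
have d1 := fu_differentiable aphi ac Uu xphi fc.
have d2 := trans_differentiable ac atheta fc ftheta.
pose T y := c_ (f x u) (f (cinv phi y) u).
have Tx : T (phi x) = c_ (f x u) (f x u) by rewrite /T cmapK.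
rewrite -Tx in d2; rewrite -Tx -(jacobian_comp d1 d2).
apply: jacobian_near; last exact: fu_differentiable.
have := near_fu Uu xphi fc; apply: filterS => y [yphi ypsi] /=.
by rewrite cmapK.
Qed.

Lemma fu_change_left u x theta phi : U u -> atlas S phi -> atlas S theta -> cdom phi x ->
  cdom theta (f x u) ->
  Jac (phi \o cinv (c_ x)) (c_ x x) *m Jac (fun y => theta (f (cinv phi y) u)) (phi x) =
  Jac (fun y => theta (f (cinv (c_ x) y) u)) (c_ x x).
Proof.
move=> Uu aphi atheta xphi ftheta.
have ac : atlas S (c_ x) by exact: chart_at_atlas.
have xc : cdom (c_ x) x by exact: chart_at_cdom.
rewrite -trans_comp//; last exact: fu_differentiable.
apply: jacobian_near; last first.
  apply: (@differentiable_comp _ _ _ _ (phi \o cinv (c_ x)) (fun z => theta (f (cinv phi z) u))).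
    exact: trans_differentiable.
  by rewrite /= cmapK//; exact: fu_differentiable.
have : \forall y \near c_ x x, cimg (c_ x) y /\ cdom phi (cinv (c_ x) y).
  by apply: near_cdom; [exact: cmap_cimg|rewrite cmapK].
by apply: filterS => y [yc yphi]; rewrite /= cmapK.
Qed.

(** The pull-back is stated through its push-forward: multiplying by the Jacobian cancels the
    [invmx] in [Ad], so both sides are free of inverses and read in fixed charts. *)
Lemma vf_coord_Ad u phi theta Y x : U u -> atlas S phi -> atlas S theta ->
  cdom phi x -> cdom theta (f x u) ->
  vf_coord S phi (Ad S f u Y) (phi x) *m Jac (fun y => theta (f (cinv phi y) u)) (phi x) =
  vf_coord S theta Y (theta (f x u)).
Proof.
move=> Uu aphi atheta xphi ftheta.
have ac : atlas S (c_ x) by exact: chart_at_atlas.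
have xc : cdom (c_ x) x by exact: chart_at_cdom.
rewrite !vf_coordE// -mulmxA fu_change_left// fu_change// /Ad /dmap JacE.
rewrite mulmxA mulmxKV//.
by apply: fu_jacobian_unit => //; [exact: chart_at_atlas|exact: chart_at_cdom].
Qed.

Lemma vf_coord_Xplus u phi theta r x : interior U u -> atlas S phi -> atlas S theta ->
  cdom phi x -> cdom theta (f x u) ->
  vf_coord S phi (Xplus S f u r) (phi x) *m Jac (fun y => theta (f (cinv phi y) u)) (phi x) =
  'D_(delta_mx 0 r) (fun v => theta (f x v)) u.
Proof.
move=> iu aphi atheta xphi ftheta; have Uu := interior_sub iu.
have ac : atlas S (c_ x) by exact: chart_at_atlas.
have xc : cdom (c_ x) x by exact: chart_at_cdom.
have ac' : atlas S (c_ (f x u)) by exact: chart_at_atlas.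
have fc : cdom (c_ (f x u)) (f x u) by exact: chart_at_cdom.
rewrite !vf_coordE// -mulmxA fu_change_left// fu_change// /Xplus /dmap JacE.
rewrite mulmxA mulmxKV; last exact: fu_jacobian_unit.
rewrite mulmx_jacobian; last exact: trans_differentiable.
rewrite -(@derive_comp _ _ _ _ (fun v => c_ (f x u) (f x v))); last 2 first.
- exact: fur_differentiable.
- exact: trans_differentiable.
apply: near_eq_derive.
have : \forall v \near u, cdom (c_ (f x u)) (f x v).
  exact: (near_preimage_open (f_continuousr (x := x) iu) (@cdom_open _ _ _ (c_ (f x u))) fc).
by apply: filterS => v vc; rewrite /= cmapK.
Qed.

(** Induction on the controls, cutting after the first step in the chart chosen at its end point.
    For the empty sequence the map is a change of charts, inverted by the opposite change. *)
Lemma flow_jacobian (s : seq 'rV[R]_m) phi psi x :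
  (forall v, v \in s -> U v) -> atlas S phi -> atlas S psi -> cdom phi x ->
  cdom psi (foldl f x s) ->
  let Phi := fun y => psi (foldl f (cinv phi y) s) in
  [/\ \forall y \near phi x, cimg phi y /\ cdom psi (foldl f (cinv phi y) s),
   differentiable Phi (phi x), Jac Phi (phi x) \in unitmx &
   forall X, vf_coord S phi (foldr (Ad S f) X s) (phi x) *m Jac Phi (phi x) =
     vf_coord S psi X (psi (foldl f x s))].
Proof.
elim: s phi x => [|u s IH] phi x Us aphi apsi xphi spsi Phi.
  have ac : atlas S (c_ x) by exact: chart_at_atlas.
  have xc : cdom (c_ x) x by exact: chart_at_cdom.
  have dP : differentiable Phi (phi x) by exact: trans_differentiable.
  split => //.
  - by apply: near_cdom; [exact: cmap_cimg|rewrite cmapK].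
  - pose B := phi \o cinv psi.
    have dB : differentiable B (Phi (phi x)).
      by rewrite /Phi/= cmapK//; exact: trans_differentiable.
    have JJ := jacobian_comp dP dB.
    suff H : Jac (B \o Phi) (phi x) = 1%:M.
      by move: JJ; rewrite H => /esym/mulmx1_unit[].
    rewrite -(jacobian_id (phi x)); apply: jacobian_near; last exact: differentiable_comp.
    have : \forall y \near phi x, cimg phi y /\ cdom psi (cinv phi y).
      by apply: near_cdom; [exact: cmap_cimg|rewrite cmapK].
    by apply: filterS => y [yphi ypsi]; rewrite /B/Phi/= cmapK// cinvK.
  - move=> X; rewrite /= !vf_coordE// -mulmxA; congr (_ *m _).
    rewrite -(@trans_comp (c_ x) phi psi)//.
    apply: jacobian_near; last first.
      apply: (@differentiable_comp _ _ _ _ (phi \o cinv (c_ x)) Phi).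
        exact: trans_differentiable.
      by rewrite /= cmapK.
    have : \forall y \near c_ x x, cimg (c_ x) y /\ cdom phi (cinv (c_ x) y).
      by apply: near_cdom; [exact: cmap_cimg|rewrite cmapK].
    by apply: filterS => y [yc yphi]; rewrite /Phi/= cmapK.
have Uu : U u by apply: Us; rewrite mem_head.
have Us' v : v \in s -> U v by move=> vs; apply: Us; rewrite inE vs orbT.
pose theta := c_ (f x u).
have at_ : atlas S theta by exact: chart_at_atlas.
have ft : cdom theta (f x u) by exact: chart_at_cdom.
have [near1 d1 u1 e1] := IH theta (f x u) Us' at_ apsi ft spsi.
have d0 := fu_differentiable aphi at_ Uu xphi ft.
have uu := fu_jacobian_unit aphi at_ Uu xphi ft.
pose T y := theta (f (cinv phi y) u).
pose P1 y := psi (foldl f (cinv theta y) s).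
have Tx : T (phi x) = theta (f x u) by rewrite /T cmapK.
have nearT := near_fu Uu xphi ft.
have PhiE : \forall y \near phi x, P1 (T y) = Phi y.
  by apply: filterS nearT => y [yphi yt]; rewrite /P1 /T/= cmapK.
have dPT : differentiable (P1 \o T) (phi x).
  by apply: differentiable_comp => //; rewrite Tx.
have JE : Jac Phi (phi x) = Jac T (phi x) *m Jac P1 (theta (f x u)).
  rewrite -Tx -jacobian_comp//; last by rewrite Tx.
  by apply/esym; apply: jacobian_near.
split.
- have := differentiable_continuous d0; rewrite -/T => Tc.
  have nT : \forall y \near phi x, cdom psi (foldl f (cinv theta (T y)) s).
    have H : \forall z \near T (phi x), cdom psi (foldl f (cinv theta z) s).
      by rewrite Tx; apply: filterS near1 => y [].
    exact: (Tc _ H).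
  by move: nearT; apply: filterS2 nT => y H [yphi yt]; split => //; move: H; rewrite /T cmapK.
- exact: near_eq_differentiable dPT.
- by rewrite JE unitmx_mul uu.
- by move=> X; rewrite JE mulmxA /= vf_coord_Ad.
Qed.

End Local.

(** * The flow in charts *)

Section Flow.
Context {R : realType} {n m : nat} {M : topologicalType}.
Variable S : smooth_manifold R n M.
Variables (U : set 'rV[R]_m) (f : M -> 'rV[R]_m -> M).
Hypothesis f_C2 : has_Ck_extension S 2 U f.
Variables (P : normedModType R) (cP : coords P).
Variables (init : P -> M) (c : nat -> P -> 'rV[R]_m) (p0 : P) (D0 : set P).

(** Initial point and controls both depend on an abstract parameter, because this is used twice:
    with a moving initial point and frozen controls it gives Phi_i, with a frozen initial point and
    moving controls the perturbed trajectory. The common base trajectory [xs] supplies the same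
    charts for both. *)
Definition flow i p := foldl f (init p) [seq c j p | j <- iota 0 i].

Lemma flowS i p : flow i.+1 p = f (flow i p) (c i p).
Proof. by rewrite /flow -[i.+1]addn1 iotaD map_cat foldl_cat. Qed.

Variable xs : nat -> M.
Hypothesis xsE : forall i, flow i p0 = xs i.

Local Notation ch i := (chart_at S (xs i)).

Lemma base_cdom i : cdom (ch i) (flow i p0).
Proof. by rewrite xsE; exact: chart_at_cdom. Qed.

Definition flow_coord i p := ch i (flow i p).

Hypothesis D0_open : open D0.
Hypothesis D0p0 : D0 p0.
Hypothesis init_cdom : forall p, D0 p -> cdom (ch 0) (init p).
Hypothesis init_continuous : forall p, D0 p -> {for p, continuous init}.
Hypothesis init_Ck : Ck_on 2 D0 (flow_coord 0).
Hypothesis c_int : forall i, interior U (c i p0).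
Hypothesis c_Ck : forall i, Ck_on 2 setT (c i).

Lemma flow_coordS i p : cdom (ch i) (flow i p) ->
  flow_coord i.+1 p = step_coord f (ch i) (ch i.+1) (flow_coord i p, c i p).
Proof. by move=> H; rewrite /flow_coord /step_coord/= cmapK// (flowS i p). Qed.

Lemma c_differentiable i p : differentiable (c i) p.
Proof. exact: (@Ck_on_diff _ _ _ 1 setT (c i) p (c_Ck i)). Qed.

Lemma c_continuous i : continuous (c i).
Proof.
by move=> p; exact: differentiable_continuous (c_differentiable i p).
Qed.

(** The domain depends on i: at each step it shrinks so that the control remains interior and the
    new state remains in the chart at the base point. Continuity of the flow into M is carried along
    because it makes the smaller domain open. *)
Lemma flow_Ck i : exists D, [/\ open D, D p0,
  forall p, D p -> cdom (ch i) (flow i p),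
  forall p, D p -> {for p, continuous (flow i)} & Ck_on 2 D (flow_coord i)].
Proof.
elim: i => [|i [D [oD Dp0 Dc Dcont DCk]]]; first by exists D0; split.
pose D' := [set p | [/\ D p, interior U (c i p) & cdom (ch i.+1) (flow i.+1 p)]].
have ptc p : D p -> interior U (c i p) -> {for p, continuous (flow i.+1)}.
  move=> Dp ip; have -> : flow i.+1 = (fun q => f q.1 q.2) \o (fun p => (flow i p, c i p)).
    by apply/funext => q; rewrite flowS.
  apply: continuous_comp; last exact: (f_continuous f_C2).
  by apply: pair_continuous_at; [exact: Dcont|exact: c_continuous].
have oD' : open D'.
  rewrite openE => p [Dp ip cp].
  have n1 : \forall q \near p, D q by exact: open_nbhs_nbhs.
  have n2 : \forall q \near p, interior U (c i q).
    exact: (near_preimage_open (@c_continuous i p) (@open_interior _ U) ip).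
  have n3 : \forall q \near p, cdom (ch i.+1) (flow i.+1 q).
    exact: (near_preimage_open (ptc p Dp ip) (@cdom_open _ _ _ (ch i.+1)) cp).
  by near=> q; split; near: q.
exists D'; split => //.
- by split => //; exact: base_cdom.
- by move=> p [].
- by move=> p [Dp ip _]; exact: ptc.
apply: (@Ck_on_ext _ _ _ _ _ (step_coord f (ch i) (ch i.+1) \o (fun p => (flow_coord i p, c i p)))) => //.
  by move=> p [Dp _ _]; rewrite flow_coordS//; exact: Dc.
apply: (@Ck_on_comp _ _ _ _ (coords_prod (coords_rV n) (coords_rV m)) _ _ (step_dom U f (ch i) (ch i.+1))) => //.
- move=> p [Dp ip cp]; split => //=; first by apply: cmap_cimg; exact: Dc.
  by rewrite /flow_coord cmapK -?(flowS i p)//; exact: Dc.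
- apply: Ck_on_pair => //; first by apply: Ck_on_sub DCk => p [].
  by apply: Ck_on_sub (c_Ck i).
- by apply: (step_coord_Ck f_C2); exact: chart_at_atlas.
Unshelve. all: by end_near. Qed.

Local Notation g i := (step_coord f (ch i) (ch i.+1)).
Local Notation q i := (flow_coord i p0, c i p0).

Lemma step_dom_base i : step_dom U f (ch i) (ch i.+1) (q i).
Proof.
split => //=; first exact/cmap_cimg/base_cdom.
by rewrite /flow_coord cmapK; [rewrite -(flowS i p0)|]; exact: base_cdom.
Qed.

Lemma step_coord_base_Ck i : Ck_on 2 (step_dom U f (ch i) (ch i.+1)) (g i).
Proof. by apply: (step_coord_Ck f_C2); exact: chart_at_atlas. Qed.

Lemma flow_local i : exists D, [/\ open D, D p0, Ck_on 2 D (flow_coord i), Ck_on 2 D (flow_coord i.+1) &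
  forall p, D p -> cdom (ch i) (flow i p) /\ step_dom U f (ch i) (ch i.+1) (flow_coord i p, c i p)].
Proof.
have [D1 [oD1 D1p D1c D1cont D1Ck]] := flow_Ck i.
have [D2 [oD2 D2p D2c D2cont D2Ck]] := flow_Ck i.+1.
pose D := D1 `&` D2 `&` [set p | interior U (c i p)].
have oD : open D.
  apply: openI; first exact: openI.
  by apply: open_comp; [move=> p _; exact: c_continuous|exact: open_interior].
have DD1 : D `<=` D1 by move=> p [[]].
have DD2 : D `<=` D2 by move=> p [[]].
exists D; split => //.
- by split; [split|exact: c_int].
- exact: (Ck_on_sub DD1 D1Ck).
- exact: (Ck_on_sub DD2 D2Ck).
- move=> p [[/D1c c1 /D2c c2] ip]; split => //; split => //=; first exact: cmap_cimg.
  by rewrite /flow_coord cmapK -?(flowS i p).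
Qed.

Lemma derive_pair (V E1 E2 : normedModType R) (F : V -> E1) (G : V -> E2) x z :
  differentiable F x -> differentiable G x ->
  'D_z (fun p => (F p, G p)) x = ('D_z F x, 'D_z G x).
Proof.
move=> dF dG; rewrite !deriveE//; last exact: differentiable_pair.
by rewrite diff_pair.
Qed.

Lemma c_derive_differentiable i z p : differentiable ('D_z (c i)) p.
Proof. by have [_ /(_ z)[H _]] := c_Ck i; exact: H. Qed.

(** An identity at [p0] alone could not be differentiated once more; hence the neighbourhood. *)
Lemma derive_flow_coordS_near i : \forall p \near p0, forall z, 'D_z (flow_coord i.+1) p =
  'D_('D_z (flow_coord i) p, 'D_z (c i) p) (g i) (flow_coord i p, c i p).
Proof.
have [D [oD Dp [C1 _] _ H]] := flow_local i.
apply: (near_open oD Dp) => p Dpp z; have [cp gp] := H p Dpp.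
have dg : differentiable (g i) (flow_coord i p, c i p).
  by have [G _] := step_coord_base_Ck i; exact: G.
have dc := c_differentiable i p; have dX := C1 _ Dpp.
have dp : differentiable (fun p => (flow_coord i p, c i p)) p by exact: differentiable_pair.
rewrite -(derive_pair z dX dc) -(derive_comp z dp dg).
apply: near_eq_derive; apply: (near_open oD Dpp) => r /H[cr _].
by rewrite flow_coordS.
Qed.

Lemma derive_flow_coordS i z : 'D_z (flow_coord i.+1) p0 =
  'D_('D_z (flow_coord i) p0, 'D_z (c i) p0) (g i) (q i).
Proof. exact: (nbhs_singleton (derive_flow_coordS_near i) z). Qed.

Lemma hess_flow_coordS i z' z : hess (flow_coord i.+1) p0 z' z =
  'D_(hess (flow_coord i) p0 z' z, hess (c i) p0 z' z) (g i) (q i) +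
  hess (g i) (q i) ('D_z' (flow_coord i) p0, 'D_z' (c i) p0) ('D_z (flow_coord i) p0, 'D_z (c i) p0).
Proof.
have [D [oD Dp [C1 C2] _ H]] := flow_local i.
have nE : \forall p \near p0, 'D_z (flow_coord i.+1) p =
    'D_('D_z (flow_coord i) p, 'D_z (c i) p) (g i) (flow_coord i p, c i p).
  by apply: filterS (derive_flow_coordS_near i).
rewrite /hess (near_eq_derive _ nE).
have dc := c_differentiable i p0; have dX := C1 _ Dp.
have [/(_ _ Dp) dX2 _] := C2 z; have dc2 := c_derive_differentiable i z p0.
rewrite -(derive_pair z' dX2 dc2) -(derive_pair z' dX dc).
apply: (@derive_along _ _ _ _ (coords_prod (coords_rV n) (coords_rV m)) (step_dom U f (ch i) (ch i.+1)) (fun p => (flow_coord i p, c i p)) (fun p => ('D_z (flow_coord i) p, 'D_z (c i) p))).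
- exact: (step_dom_open f_C2).
- exact: step_dom_base.
- exact: step_coord_base_Ck.
- exact: differentiable_pair.
- exact: differentiable_pair.
Qed.

End Flow.

(** * Algebra of the variations *)

Section Variation.
Variables (V E : zmodType).
Variables (phi A : nat -> V -> V) (phi2 : nat -> V -> V -> V)
  (B : nat -> V * E -> V * E -> V) (Y Z b xi zeta : nat -> V) (dY : nat -> V -> V)
  (a : nat -> E).
Hypothesis phiD : forall i x y, phi i (x + y) = phi i x + phi i y.
Hypothesis AD : forall i x y, A i (x + y) = A i x + A i y.
Hypothesis phi2D : forall i x y z, phi2 i x (y + z) = phi2 i x y + phi2 i x z.
Hypothesis phi2C : forall i x y, phi2 i x y = phi2 i y x.
Hypothesis BD : forall i x y z, B i x (y + z) = B i x y + B i x z.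
Hypothesis BC : forall i x y, B i x y = B i y x.
Hypothesis phiS : forall i x, phi i.+1 x = A i (phi i x).
Hypothesis phi2S : forall i x y,
  phi2 i.+1 x y = A i (phi2 i x y) + B i (phi i x, 0) (phi i y, 0).
Hypothesis phi20 : phi2 0 0 0 = 0.
Hypothesis xi0 : xi 0 = 0.
Hypothesis zeta0 : zeta 0 = 0.
Hypothesis xiS : forall i, xi i.+1 = A i (xi i) + b i.
Hypothesis zetaS : forall i,
  zeta i.+1 = A i (zeta i) + B i (xi i, a i) (xi i, a i).
Hypothesis Y_eq : forall i, phi i.+1 (Y i) = b i.
Hypothesis dY_eq : forall i x,
  phi i.+1 (dY i x) + phi2 i.+1 x (Y i) = B i (phi i x, 0) (0, a i).
Hypothesis Z_eq : forall i,
  phi i.+1 (Z i) + B i (0, a i) (phi i (Y i), 0) = B i (0, a i) (0, a i).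

Let eta i := \sum_(0 <= j < i) Y j.
Let psi i := \sum_(0 <= j < i) (Z j + dY j (eta j) + dY j (eta j) + dY j (Y j)).

Lemma additive0 (f : V -> V) : (forall x y, f (x + y) = f x + f y) -> f 0 = 0.
Proof. by move=> fD; apply: (addrI (f 0)); rewrite -fD !addr0. Qed.

(** In the application [phi i] and [phi2 i] are the first two derivatives of Phi_i, [A i] is the
    state derivative of step i and [B i] its second derivative on pairs (state, control); [b i] is
    the effect of the control perturbation [a i], and [xi], [zeta] are the two variations of the
    state. [dY_eq] and [Z_eq] come from differentiating the push-forward equations of Y and X^+. *)
Lemma variations i :
  xi i = phi i (eta i) /\ zeta i = phi i (psi i) + phi2 i (eta i) (eta i).
Proof.
elim: i => [|i [IH1 IH2]].
  by rewrite /eta /psi !big_nil xi0 zeta0 phi20 (additive0 (@phiD 0)) addr0.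
have etaS : eta i.+1 = eta i + Y i by rewrite /eta big_nat_recr.
have psiS : psi i.+1 = psi i + (Z i + dY i (eta i) + dY i (eta i) + dY i (Y i)).
  by rewrite /psi big_nat_recr.
split; first by rewrite xiS IH1 -phiS -Y_eq -phiD -etaS.
have phi2Dl x y z : phi2 i.+1 (x + y) z = phi2 i.+1 x z + phi2 i.+1 y z.
  by rewrite phi2C phi2D !(phi2C _ z).
have BDl x y z : B i (x + y) z = B i x z + B i y z by rewrite BC BD !(BC _ z).
(* [B i] is expanded on (state, 0) + (0, control). The pure state part is absorbed by [phi2S]; the
   two mixed parts and the pure control part remain. *)
have -> : zeta i.+1 = phi i.+1 (psi i) + phi2 i.+1 (eta i) (eta i) +
    (B i (phi i (eta i), 0) (0, a i) + B i (phi i (eta i), 0) (0, a i)) +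
    B i (0, a i) (0, a i).
  rewrite zetaS IH1 IH2.
  rewrite (_ : (phi i (eta i), a i) = (phi i (eta i), 0) + (0, a i)); last first.
    by congr pair; rewrite /= ?addr0 ?add0r.
  rewrite BDl !BD (BC _ (0, a i) (phi i (eta i), 0)) phi2S phiS AD !addrA.
  by [].
(* [Z_eq] leaves one further mixed term, to which [dY_eq] applies with x = [Y i]; this is the origin
   of the summand [dY i (Y i)]. *)
rewrite -dY_eq -Z_eq BC -dY_eq etaS psiS phi2D !phi2Dl !phiD.
rewrite (phi2C _ (Y i) (eta i)).
by rewrite [LHS](+%R.[AC ((2*(2*2))*(1*2)) ((1*(7*3*5*8))*((2*4)*(6*9)))]).
Qed.

End Variation.

Section BracketSum.
Variables (K : numFieldType) (V : lmodType K) (N : nat).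
Variables (Y Z : nat -> V) (dY : nat -> V -> V).
Hypothesis dYD : forall i x y, dY i (x + y) = dY i x + dY i y.

Lemma half_double (x : V) : 2^-1 *: (x + x) = x.
Proof. by rewrite scalerDr -scalerDl (_ : 2^-1 + 2^-1 = 1) ?scale1r//; field. Qed.

(** As the Y_j sum to zero, one of the two copies of the sum over j < i equals minus the sum over j
    >= i. The term [dY i (Y i)] then cancels, leaving the sum over j < i minus the sum over j > i of
    dY_i(Y_j); averaging with the transposed double sum produces half brackets. *)
Lemma bracket_sum : \sum_(0 <= j < N) Y j = 0 ->
  \sum_(0 <= i < N) (Z i + dY i (\sum_(0 <= j < i) Y j) +
     dY i (\sum_(0 <= j < i) Y j) + dY i (Y i)) =
  \sum_(i < N) \sum_(j < N)
    (if (i < j)%N then 2^-1 *: (dY j (Y i) - dY i (Y j))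
     else if (j < i)%N then 2^-1 *: (dY i (Y j) - dY j (Y i)) else Z i).
Proof.
move=> Y0.
have dY0 i : dY i 0 = 0 by apply: (addrI (dY i 0)); rewrite -dYD !addr0.
have dYsum i (I : finType) (P : pred I) (F : I -> V) : dY i (\sum_(j | P j) F j) = \sum_(j | P j) dY i (F j).
  exact: (big_morph (dY i) (dYD i) (dY0 i)).
pose k (i j : 'I_N) := if (j < i)%N then dY i (Y j) else
  if (i < j)%N then - dY i (Y j) else Z i.
transitivity (\sum_(i < N) \sum_(j < N) k i j); last first.
  have E : \sum_(i < N) \sum_(j < N) k i j = \sum_(i < N) \sum_(j < N) k j i.
    exact: exchange_big.
  have -> : \sum_(i < N) \sum_(j < N) k i j = 2^-1 *:
      (\sum_(i < N) \sum_(j < N) k i j + \sum_(i < N) \sum_(j < N) k j i).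
    by rewrite -E half_double.
  rewrite -big_split scaler_sumr; apply: eq_bigr => i _ /=.
  rewrite -big_split scaler_sumr; apply: eq_bigr => j _ /=.
  rewrite /k; case: ltngtP => [ij|ji|ij].
  - by [].
  - by rewrite addrC.
  - rewrite (val_inj ij : j = i).
    by rewrite half_double.
rewrite big_mkord; apply: eq_bigr => i _.
have Yi : \sum_(0 <= j < i) Y j = \sum_(j < N | (j < i)%N) Y j.
  by rewrite big_mkord (big_ord_widen N Y)// ltnW.
have kE : \sum_(j < N) k i j = \sum_(j < N | (j < i)%N) dY i (Y j) -
    \sum_(j < N | (i < j)%N) dY i (Y j) + Z i.
  rewrite (bigD1 i)//= {1}/k ltnn addrC; congr (_ + _).
  rewrite (bigID (fun j : 'I_N => (j < i)%N))/=; congr (_ + _).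
    apply: eq_big => [j|j /andP[_ ji]]; last by rewrite /k ji.
    by case: eqVneq => //= ->; rewrite ltnn.
  rewrite -sumrN; apply: eq_big => [j|j /andP[ji]].
    by rewrite -leqNgt ltn_neqAle eq_sym.
  by rewrite -leqNgt /k => ij; rewrite ltnNge ij /= ltn_neqAle ij andbT eq_sym ji.
have dYY : \sum_(j < N | (i < j)%N) dY i (Y j) =
    - (\sum_(j < N | (j < i)%N) dY i (Y j) + dY i (Y i)).
  have tot : \sum_(j < N) dY i (Y j) = 0.
    by rewrite -dYsum -(big_mkord xpredT) Y0 dY0.
  apply: (addIr (\sum_(j < N | (j < i)%N) dY i (Y j) + dY i (Y i))).
  rewrite addNr -[RHS]tot [RHS](bigD1 i)//= [in RHS](bigID (fun j : 'I_N => (j < i)%N))/=.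
  rewrite addrC -addrA addrCA; congr (_ + (_ + _)).
    by apply: eq_bigl => j; case: (ltngtP j i) => [ji|ji|/val_inj ->];
       rewrite ?eqxx// -?val_eqE/= ?(ltn_eqF ji) ?(gtn_eqF ji).
  by apply: eq_bigl => j; case: (ltngtP j i) => [ji|ji|/val_inj ->];
     rewrite ?eqxx// -?val_eqE/= ?(ltn_eqF ji) ?(gtn_eqF ji).
rewrite kE dYY Yi dYsum opprK.
by rewrite [LHS](+%R.[AC (3*1) ((2*(3*4))*1)]).
Qed.

End BracketSum.

(** * Differentiability of products with inverse matrices *)

Section InverseMatrix.
Context {R : realType}.
Implicit Types V : normedModType R.

Lemma differentiable_mxP V p (F : V -> 'rV[R]_p) x :
  (forall j, differentiable (fun y => F y 0 j : R) x) -> differentiable F x.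
Proof.
move=> H; rewrite (_ : F = fun y => \sum_j (F y 0 j : R) *: (delta_mx 0 j : 'rV[R]_p)).
  apply: differentiable_bigsum => j; apply: differentiable_scale => //.
by apply/funext => y; exact: row_sum_delta.
Qed.

Lemma differentiable_row V p (F : V -> 'rV[R]_p) x j :
  differentiable F x -> differentiable (fun y => F y 0 j : R) x.
Proof.
move=> dF; apply: (@differentiable_comp _ _ _ _ F (fun z : 'rV[R]_p => z 0 j : R)) => //.
exact: differentiable_coord.
Qed.

Lemma differentiable_det V p (F : V -> 'M[R]_p) x :
  (forall i j, differentiable (fun y => F y i j : R) x) ->
  differentiable (fun y => \det (F y) : R) x.
Proof.
move=> H; rewrite /determinant.
have dprod (s : 'S_p) : differentiable (fun y => (-1) ^+ s * \prod_i F y i (s i) : R) x; last first.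
  exact: (differentiable_bigsum dprod).
apply: (@differentiableM _ _ (cst _)) => //.
rewrite (_ : (fun y => _) = \prod_i (fun y => F y i (s i) : R)); last first.
  by apply/funext => y; rewrite (@big_morph _ _ (fun h : V -> R => h y) 1 *%R 1 *%R).
by elim/big_ind : _ => [|f g df dg|//]; [exact: differentiable_cst|exact: differentiableM].
Qed.

(** Cramer's formula, valid near [x] because the determinant stays nonzero. Only differentiability
    is recorded: the derivatives themselves are found from equations without inverses. *)
Lemma differentiable_mul_invmx V p (b : V -> 'rV[R]_p) (F : V -> 'M[R]_p) x :
  differentiable b x -> (forall i j, differentiable (fun y => F y i j : R) x) ->
  F x \in unitmx -> differentiable (fun y => b y *m invmx (F y)) x.
Proof.
move=> db dF Fx.
have ddet := differentiable_det dF.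
have det0 : \det (F x) != 0 by rewrite -unitfE.
have nU : \forall y \near x, F y \in unitmx.
  have := differentiable_continuous ddet => /(_ _ _) dc.
  have : \forall y \near x, \det (F y) != 0.
    have := @near_preimage_open _ _ (fun y => \det (F y)) [set z : R | z != 0] x dc (@open_neq R 0) det0.
    exact.
  by apply: filterS => y; rewrite unitmxE unitfE.
apply: (@near_eq_differentiable _ _ _ (fun y => b y *m ((\det (F y))^-1 *: \adj (F y)))).
  by apply: filterS nU => y Fy; rewrite /invmx Fy.
apply: differentiable_mxP => j.
rewrite (_ : (fun y => _) = (fun y => \sum_k (b y 0 k : R) * ((\det (F y))^-1 * cofactor (F y) j k))); last first.
  by apply/funext => y; rewrite !mxE; apply: eq_bigr => k _; rewrite !mxE.
apply: (@differentiable_bigsum R V R _ (fun k y => (b y 0 k : R) * ((\det (F y))^-1 * cofactor (F y) j k))) => k.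
apply: (@differentiableM _ _ (fun y => b y 0 k : R)); first exact: differentiable_row.
apply: (@differentiableM _ _ (fun y => (\det (F y))^-1)).
  exact: (differentiableV ddet det0).
apply: (@differentiableM _ _ (cst _)) => //.
apply: differentiable_det => i l.
rewrite (_ : (fun y => _) = (fun y => F y (lift j i) (lift k l) : R)) //.
by apply/funext => y; rewrite !mxE.
Qed.

End InverseMatrix.

(** * Differentiated equations for the pulled-back fields *)

Section KeyFacts.
Context {R : realType} {n m : nat} {M : topologicalType}.
Variable S : smooth_manifold R n M.
Variables (U : set 'rV[R]_m) (f : M -> 'rV[R]_m -> M).
Hypothesis f_C2 : has_Ck_extension S 2 U f.
Hypothesis f_diffeo : forall u, U u -> Ck_diffeo_onto_open S 2 (f^~ u).
Variables (x0 : M) (u : nat -> 'rV[R]_m).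
Hypothesis u_int : forall j, interior U (u j).

Definition ctrl i := [seq u j | j <- iota 0 i].
Definition traj i := foldl f x0 (ctrl i).
Local Notation ch i := (chart_at S (traj i)).
Local Notation y0 := (ch 0 x0).
Local Notation Phi := (flow_coord S f (cinv (ch 0)) (fun j _ => u j) traj).
Local Notation g i := (step_coord f (ch i) (ch i.+1)).
Local Notation y_ i := (ch i (traj i)).
Local Notation e_ r := (delta_mx 0 r : 'rV[R]_m).
Local Notation crd := (coords_prod (coords_rV n) (coords_rV m)).

Lemma traj_cdom i : cdom (ch i) (traj i).
Proof. exact: chart_at_cdom. Qed.

Lemma ctrl_U i v : v \in ctrl i -> U v.
Proof. by move=> /mapP[j _ ->]; exact: interior_sub. Qed.

Lemma trajS i : traj i.+1 = f (traj i) (u i).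
Proof. by rewrite /traj /ctrl -[i.+1]addn1 iotaD map_cat foldl_cat. Qed.

Lemma cimg_y0 : cimg (ch 0) y0.
Proof. exact/cmap_cimg/traj_cdom. Qed.

Lemma flow_base i : flow f (cinv (ch 0)) (fun j _ => u j) i y0 = traj i.
Proof. by rewrite /flow cmapK//; exact: traj_cdom. Qed.

Lemma Phi_base i : Phi i y0 = y_ i.
Proof. by rewrite /flow_coord flow_base. Qed.

Lemma Phi0_Ck : Ck_on 2 (cimg (ch 0)) (Phi 0).
Proof.
apply: (@Ck_on_ext _ _ _ _ _ (idfun : {linear 'rV[R]_n -> 'rV[R]_n})).
- exact: cimg_open.
- by move=> y yc; rewrite /flow_coord /flow/= cinvK.
- by apply: Ck_on_linear => x; exact: id_continuous_at.
Qed.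

Let initc : forall p, cimg (ch 0) p -> cdom (ch 0) (cinv (ch 0) p).
Proof. by move=> p; exact: cinv_cdom. Qed.

Let initcont : forall p, cimg (ch 0) p -> {for p, continuous (cinv (ch 0))}.
Proof. by move=> p; exact: cinv_continuous. Qed.

Let cCk : forall i : nat, Ck_on 2 [set: 'rV[R]_n] (fun=> u i).
Proof. by move=> i; exact: Ck_on_cst. Qed.

Lemma Phi_Ck i : exists D, [/\ open D, D y0,
   forall y, D y -> cdom (ch i) (foldl f (cinv (ch 0) y) (ctrl i)) & Ck_on 2 D (Phi i)].
Proof.
have [D [oD Dy Dc _ DC]] := flow_Ck f_C2 flow_base (@cimg_open _ _ _ (ch 0)) cimg_y0
  initc initcont Phi0_Ck u_int cCk i.
by exists D.
Qed.

Lemma derive_PhiS_near i : \forall y \near y0, forall z,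
  'D_z (Phi i.+1) y = 'D_('D_z (Phi i) y, 0) (g i) (Phi i y, u i).
Proof.
have := derive_flow_coordS_near f_C2 flow_base (@cimg_open _ _ _ (ch 0)) cimg_y0
  initc initcont Phi0_Ck u_int cCk i.
by apply: filterS => y H z; rewrite H derive_cst.
Qed.

Lemma hess_cst (V W : normedModType R) (a : W) (x : V) z' z : hess (fun _ : V => a) x z' z = 0.
Proof.
rewrite /hess (_ : 'D_z _ = fun=> 0); first exact: derive_cst.
by apply/funext => y; exact: derive_cst.
Qed.

Lemma hess_PhiS i z' z : hess (Phi i.+1) y0 z' z =
  'D_(hess (Phi i) y0 z' z, 0) (g i) (y_ i, u i) +
  hess (g i) (y_ i, u i) ('D_z' (Phi i) y0, 0) ('D_z (Phi i) y0, 0).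
Proof.
have := hess_flow_coordS f_C2 flow_base (@cimg_open _ _ _ (ch 0)) cimg_y0
  initc initcont Phi0_Ck u_int cCk i z' z.
by rewrite Phi_base !derive_cst hess_cst.
Qed.

Lemma g_base i : step_dom U f (ch i) (ch i.+1) (y_ i, u i).
Proof.
split => //=; first exact/cmap_cimg/traj_cdom.
by rewrite cmapK -?trajS; exact: traj_cdom.
Qed.

Lemma g_Ck i : Ck_on 2 (step_dom U f (ch i) (ch i.+1)) (g i).
Proof. by apply: (step_coord_Ck f_C2); exact: chart_at_atlas. Qed.

Lemma derive_partl (V E W : normedModType R) (F : V * E -> W) y v z :
  differentiable F (y, v) -> 'D_z (fun y => F (y, v)) y = 'D_(z, 0) F (y, v).
Proof.
move=> dF; have dp : differentiable (fun y : V => (y, v)) y by exact: differentiable_pair.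
rewrite (derive_comp z dp dF) derive_pair//.
by rewrite derive_id derive_cst.
Qed.

Lemma derive_partr (V E W : normedModType R) (F : V * E -> W) y v z :
  differentiable F (y, v) -> 'D_z (fun v => F (y, v)) v = 'D_(0, z) F (y, v).
Proof.
move=> dF; have dp : differentiable (fun v : E => (y, v)) v by exact: differentiable_pair.
rewrite (derive_comp z dp dF) derive_pair//.
by rewrite derive_id derive_cst.
Qed.

Definition Yfield_nat i r := foldr (Ad S f) (Xplus S f (u i) r) (ctrl i).
Definition Zfield_nat i r s := foldr (Ad S f) (dXplus S f (u i) r s) (ctrl i).
Local Notation vY i r := (vf_coord S (ch 0) (Yfield_nat i r)).

(** The definition of X^+ cleared of the inverse differential: moving the state along X^+ has the
    same first order effect as moving the control. *)
Lemma Xplus_step_coord i v r x : interior U v -> cdom (ch i) x -> cdom (ch i.+1) (f x v) ->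
  'D_(vf_coord S (ch i) (Xplus S f v r) (ch i x), 0) (g i) (ch i x, v) =
  'D_(0, e_ r) (g i) (ch i x, v).
Proof.
move=> iv xc fc.
have gd : step_dom U f (ch i) (ch i.+1) (ch i x, v).
  by split => //=; [exact: cmap_cimg|rewrite cmapK].
have dg : differentiable (g i) (ch i x, v) by have [H _] := g_Ck i; exact: H.
have df : differentiable (fun y => ch i.+1 (f (cinv (ch i) y) v)) (ch i x).
  by apply: (fu_differentiable f_diffeo) => //; [exact: chart_at_atlas|exact: chart_at_atlas|exact: interior_sub].
rewrite -(derive_partl _ dg) -(derive_partr _ dg).
rewrite -[LHS](mulmx_jacobian _ df).
rewrite (vf_coord_Xplus f_C2 f_diffeo r iv) //; try exact: chart_at_atlas.
by rewrite /step_coord/= cmapK.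
Qed.

Lemma near_flow i : \forall y \near y0,
  [/\ cimg (ch 0) y, cdom (ch i) (foldl f (cinv (ch 0) y) (ctrl i)),
   differentiable (Phi i) y, Jac (Phi i) y \in unitmx &
   forall X, vf_coord S (ch 0) (foldr (Ad S f) X (ctrl i)) y *m Jac (Phi i) y =
     vf_coord S (ch i) X (Phi i y)].
Proof.
have [D [oD Dy Dc _]] := Phi_Ck i.
have n1 : \forall y \near y0, cimg (ch 0) y.
  by apply: open_nbhs_nbhs; split; [exact: cimg_open|exact: cimg_y0].
have n2 : \forall y \near y0, D y by exact: open_nbhs_nbhs.
near=> y.
have yc : cimg (ch 0) y by near: y.
have yD : D y by near: y.
have [_] := flow_jacobian f_diffeo (@ctrl_U i) (chart_at_atlas S (traj 0))
  (chart_at_atlas S (traj i)) (cinv_cdom yc) (Dc _ yD).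
rewrite cinvK// => H1 H2 H3.
by split => //; exact: Dc.
Unshelve. all: by end_near. Qed.

(* The pull-back [Y^(ir)] is characterised by its push-forward through the first
   i+1 steps, an identity which can be differentiated without inverse matrices. *)
Lemma Y_step_coord_near i r : \forall y \near y0,
  'D_(vY i r y) (Phi i.+1) y = 'D_(0, e_ r) (g i) (Phi i y, u i).
Proof.
apply: filterS3 (near_flow i) (near_flow i.+1) (derive_PhiS_near i).
move=> y [yc y1 dP _ H] [_ y2 _ _ _] ->.
rewrite -(mulmx_jacobian _ dP) H; apply: Xplus_step_coord => //.
by move: y2; rewrite /ctrl -[i.+1]addn1 iotaD map_cat foldl_cat.
Qed.

Lemma vY_base i r : vY i r y0 = Yfield_nat i r x0.
Proof. exact: (vf_coord_chart_at S (Yfield_nat i r) x0). Qed.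

Lemma push_base i X :
  'D_(foldr (Ad S f) X (ctrl i) x0) (Phi i) y0 = X (traj i).
Proof.
have [_ _ dP _ H] := nbhs_singleton (near_flow i).
rewrite -(mulmx_jacobian _ dP) -(vf_coord_chart_at S _ x0) H Phi_base.
exact: vf_coord_chart_at.
Qed.

Lemma g_differentiable i p : step_dom U f (ch i) (ch i.+1) p -> differentiable (g i) p.
Proof. by have [H _] := g_Ck i; exact: H. Qed.

Lemma g_derive_differentiable i z p : step_dom U f (ch i) (ch i.+1) p -> differentiable ('D_z (g i)) p.
Proof. by have [_ /(_ z)[H _]] := g_Ck i; exact: H. Qed.

Lemma Phi_differentiable i : differentiable (Phi i) y0.
Proof. by have [D [_ Dy _ [H _]]] := Phi_Ck i; exact: H. Qed.

Lemma Phi_derive_differentiable i z : differentiable ('D_z (Phi i)) y0.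
Proof. by have [D [_ Dy _ [_ /(_ z)[H _]]]] := Phi_Ck i; exact: H. Qed.

(** The push-forward equation of [Y_step_coord_near] is solved for the field by inverting the
    Jacobian of Phi_(i+1). *)
Lemma vY_differentiable i r : differentiable (vY i r) y0.
Proof.
pose b y := 'D_(0, e_ r) (g i) (Phi i y, u i).
apply: (@near_eq_differentiable _ _ _ (fun y => b y *m invmx (Jac (Phi i.+1) y))).
  apply: filterS2 (near_flow i.+1) (Y_step_coord_near i r) => y [_ _ dP JU _] E.
  by rewrite /b -E -(mulmx_jacobian _ dP) mulmxK.
apply: differentiable_mul_invmx.
- apply: (@differentiable_comp _ _ _ _ (fun y => (Phi i y, u i)) ('D_(0, e_ r) (g i))).
    by apply: differentiable_pair => //; exact: Phi_differentiable.
  by rewrite Phi_base; apply: g_derive_differentiable; exact: g_base.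
- move=> k l; have d := differentiable_row l (Phi_derive_differentiable i.+1 (delta_mx 0 k)).
  apply: near_eq_differentiable d.
  have := near_flow i.+1; apply: filterS => y [_ _ dP _ _].
  by rewrite -(mulmx_jacobian _ dP) -rowE mxE.
- by have [_ _ _ H _] := nbhs_singleton (near_flow i.+1).
Qed.

Lemma Y_eq i r : 'D_(Yfield_nat i r x0) (Phi i.+1) y0 = 'D_(0, e_ r) (g i) (y_ i, u i).
Proof. by have := nbhs_singleton (Y_step_coord_near i r); rewrite vY_base Phi_base. Qed.

(** The derivative along [z] of [Y_step_coord_near]: [derive_along] on the left, the chain rule on
    the right. *)
Lemma dY_eq i r z :
  'D_('D_z (vY i r) y0) (Phi i.+1) y0 + hess (Phi i.+1) y0 z (Yfield_nat i r x0) =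
  hess (g i) (y_ i, u i) ('D_z (Phi i) y0, 0) (0, e_ r).
Proof.
have [D [oD Dy _ DC]] := Phi_Ck i.+1.
have dY := vY_differentiable i r.
have did : differentiable (id : 'rV[R]_n -> 'rV[R]_n) y0 by [].
have := @derive_along R _ _ _ (coords_rV n) D id (vY i r) (Phi i.+1) y0 z oD Dy DC
  did dY.
rewrite /= derive_id vY_base => <-.
rewrite (near_eq_derive _ (Y_step_coord_near i r)).
have dp : differentiable (fun y => (Phi i y, u i)) y0.
  by apply: differentiable_pair => //; exact: Phi_differentiable.
have dg : differentiable ('D_(0, e_ r) (g i)) (Phi i y0, u i).
  by rewrite Phi_base; apply: g_derive_differentiable; exact: g_base.
apply: (etrans (derive_comp z dp dg)).
by rewrite (derive_pair z (Phi_differentiable i) (differentiable_cst _ _)) derive_cst Phi_base.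
Qed.

(** The equation [Xplus_step_coord] is differentiated with respect to the control, the state being
    fixed at the i-th point of the trajectory. [push_base] then carries the vectors found there back
    to [x0]. *)
Lemma Z_eq i r s :
  'D_(Zfield_nat i r s x0) (Phi i.+1) y0 +
    hess (g i) (y_ i, u i) (0, e_ r) ('D_(Yfield_nat i s x0) (Phi i) y0, 0) =
  hess (g i) (y_ i, u i) (0, e_ r) (0, e_ s).
Proof.
pose W v := Xplus S f v s (traj i).
pose A v := Jac (fun y => g i (y, v)) (y_ i).
pose b v := 'D_(0, e_ s) (g i) (y_ i, v).
have nU : \forall v \near u i, interior U v by apply: open_nbhs_nbhs; split => //; exact: open_interior.
have nf : \forall v \near u i, cdom (ch i.+1) (f (traj i) v).
  apply: (near_preimage_open (f_continuousr f_C2 (x := traj i) (u_int i)) (@cdom_open _ _ _ (ch i.+1))).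
  by rewrite -trajS; exact: traj_cdom.
have gd v : interior U v -> cdom (ch i.+1) (f (traj i) v) ->
    step_dom U f (ch i) (ch i.+1) (y_ i, v).
  move=> iv fv; split => //=; first exact/cmap_cimg/traj_cdom.
  by rewrite cmapK//; exact: traj_cdom.
have nE : \forall v \near u i, 'D_(W v, 0) (g i) (y_ i, v) = b v.
  near=> v; have iv : interior U v by near: v.
  have fv : cdom (ch i.+1) (f (traj i) v) by near: v.
  rewrite /b -(Xplus_step_coord s iv (traj_cdom i) fv).
  by rewrite vf_coord_chart_at.
have dpr : differentiable (fun v : 'rV[R]_m => (y_ i, v)) (u i) by exact: differentiable_pair.
have AU v : interior U v -> cdom (ch i.+1) (f (traj i) v) -> A v \in unitmx.
  move=> iv fv; apply: (fu_jacobian_unit f_diffeo) => //; try exact: chart_at_atlas.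
  - exact: interior_sub.
  - exact: traj_cdom.
have Adg v : interior U v -> cdom (ch i.+1) (f (traj i) v) ->
    differentiable (fun y => g i (y, v)) (y_ i).
  move=> iv fv; apply: (@differentiable_comp _ _ _ _ (fun y => (y, v)) (g i)).
    exact: differentiable_pair.
  by apply: g_differentiable; exact: gd.
have db : differentiable b (u i).
  apply: (@differentiable_comp _ _ _ _ (fun v => (y_ i, v)) ('D_(0, e_ s) (g i))) => //.
  by apply: g_derive_differentiable; exact: g_base.
have dW : differentiable W (u i).
  apply: (@near_eq_differentiable _ _ _ (fun v => b v *m invmx (A v))).
    near=> v; have iv : interior U v by near: v.
    have fv : cdom (ch i.+1) (f (traj i) v) by near: v.
    have E : 'D_(W v, 0) (g i) (y_ i, v) = b v by near: v.
    have gv := g_differentiable (gd v iv fv).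
    rewrite -E -(derive_partl _ gv) -(mulmx_jacobian _ (Adg v iv fv)).
    by rewrite mulmxK//; exact: AU.
  apply: differentiable_mul_invmx => //.
  - move=> k l.
    have d : differentiable (fun v => 'D_(delta_mx 0 k, 0) (g i) (y_ i, v) 0 l) (u i).
      apply: differentiable_row.
      apply: (@differentiable_comp _ _ _ _ (fun v => (y_ i, v)) ('D_(delta_mx 0 k, 0) (g i))) => //.
      by apply: g_derive_differentiable; exact: g_base.
    apply: near_eq_differentiable d.
    near=> v; have iv : interior U v by near: v.
    have fv : cdom (ch i.+1) (f (traj i) v) by near: v.
    rewrite -(derive_partl _ (g_differentiable (gd v iv fv))) -(mulmx_jacobian _ (Adg v iv fv)).
    by rewrite -rowE mxE.
  - by apply: AU => //; rewrite -trajS; exact: traj_cdom.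
have dh : differentiable (fun v => (W v, 0 : 'rV[R]_m)) (u i) by exact: differentiable_pair.
have dg0 : differentiable ('D_(0, e_ s) (g i)) (y_ i, u i) by apply: g_derive_differentiable; exact: g_base.
have dpE : 'D_(e_ r) (fun v : 'rV[R]_m => (y_ i, v)) (u i) = (0, e_ r).
  by rewrite derive_pair// derive_id derive_cst.
have Db : 'D_(e_ r) b (u i) = hess (g i) (y_ i, u i) (0, e_ r) (0, e_ s).
  by apply: (etrans (derive_comp (e_ r) dpr dg0)); rewrite dpE.
have := @derive_along R _ _ _ crd _ (fun v => (y_ i, v)) (fun v => (W v, 0)) (g i) (u i) (e_ r)
  (@step_dom_open _ _ _ _ _ _ _ f_C2 (ch i) (ch i.+1)) (g_base i) (g_Ck i) dpr dh.
rewrite (near_eq_derive _ nE) Db dpE => ->.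
rewrite (derive_pair (e_ r) dW (differentiable_cst _ _)) derive_cst.
rewrite (push_base i (Xplus S f (u i) s)); congr (_ + _).
rewrite (nbhs_singleton (derive_PhiS_near i)) Phi_base.
by rewrite (push_base i (dXplus S f (u i) r s)).
Unshelve. all: by end_near. Qed.

End KeyFacts.

(** * Variations of the end point *)

Lemma linear_rV_sum (R : realType) k (V : lmodType R) (F : 'rV[R]_k -> V) a :
  linear F -> F a = \sum_r a 0 r *: F (delta_mx 0 r).
Proof.
move=> lF; pose l : {linear 'rV[R]_k -> V} := HB.pack F (GRing.isLinear.Build R _ _ _ F lF).
rewrite -[LHS]/(l a) [in LHS](row_sum_delta a) linear_sum.
by apply: eq_bigr => r _; rewrite linearZ.
Qed.

Lemma linear_sum_scale (R : realType) (V W : lmodType R) (F : V -> W) (I : finType)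
    (c : I -> R) (v : I -> V) :
  linear F -> F (\sum_i c i *: v i) = \sum_i c i *: F (v i).
Proof.
move=> lF; pose l : {linear V -> W} := HB.pack F (GRing.isLinear.Build R _ _ _ F lF).
by rewrite -[LHS]/(l _) linear_sum; apply: eq_bigr => i _; rewrite linearZ.
Qed.

Section Endpoint.
Context {R : realType} {n m : nat} {M : topologicalType}.
Variable S : smooth_manifold R n M.
Variables (U : set 'rV[R]_m) (f : M -> 'rV[R]_m -> M).
Hypothesis f_C2 : has_Ck_extension S 2 U f.
Hypothesis f_diffeo : forall u, U u -> Ck_diffeo_onto_open S 2 (f^~ u).
Variables (x0 : M) (u : nat -> 'rV[R]_m).
Hypothesis u_int : forall j, interior U (u j).
Variable N : nat.

Local Notation traj := (traj f x0 u).
Local Notation ch i := (chart_at S (traj i)).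
Local Notation y0 := (ch 0 x0).
Local Notation Phi := (flow_coord S f (cinv (ch 0)) (fun j _ => u j) traj).
Local Notation g i := (step_coord f (ch i) (ch i.+1)).
Local Notation y_ i := (ch i (traj i)).
Local Notation e_ r := (delta_mx 0 r : 'rV[R]_m).
Local Notation vY i r := (vf_coord S (ch 0) (Yfield_nat S f u i r)).

(** Steps are numbered by all natural numbers; from N on the perturbation is zero. *)
Definition row_nat j (a : 'M[R]_(N, m)) : 'rV[R]_m :=
  if (insub j : option 'I_N) is Some i then row i a else 0.

Lemma row_nat_ord (i : 'I_N) a : row_nat i a = row i a.
Proof. by rewrite /row_nat valK. Qed.

(** Perturbations are flattened to row vectors, the source space of the minimisation argument. *)
Definition perturb j (w : 'rV[R]_(N * m)) := row_nat j (vec_mx w).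

Lemma perturb_is_linear j : linear (perturb j).
Proof.
move=> c w z; rewrite /perturb /row_nat !linearP/=; case: insub => [i|].
  by rewrite linearP.
by rewrite scaler0 addr0.
Qed.
HB.instance Definition _ j :=
  GRing.isLinear.Build R 'rV[R]_(N * m) 'rV[R]_m _ (perturb j) (perturb_is_linear j).

Definition perturbed j (w : 'rV[R]_(N * m)) := u j + perturb j w.
Local Notation X := (flow_coord S f (fun _ => x0) perturbed traj).

Lemma perturbed_Ck j : Ck_on 2 setT (perturbed j).
Proof.
apply: Ck_on_add; [exact: openT|exact: Ck_on_cst|].
by apply: Ck_on_linear; exact: continuous_linear_rV.
Qed.

Lemma derive_perturbed j w x : 'D_w (perturbed j) x = perturb j w.
Proof.
rewrite deriveD ?derive_cst ?add0r; last 2 first.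
- exact: derivable_cst.
- by apply: diff_derivable; apply: linear_differentiable; exact: continuous_linear_rV.
by rewrite derive_linear//; exact: continuous_linear_rV.
Qed.

Lemma hess_perturbed j w z x : hess (perturbed j) x z w = 0.
Proof.
rewrite /hess (_ : 'D_w (perturbed j) = fun=> perturb j w); first exact: derive_cst.
by apply/funext => y; exact: derive_perturbed.
Qed.

Lemma perturbed0 j : perturbed j 0 = u j.
Proof. by rewrite /perturbed linear0 addr0. Qed.

Lemma flow_perturbed i : flow f (fun _ : 'rV[R]_(N * m) => x0) perturbed i 0 = traj i.
Proof. by rewrite /flow /traj /ctrl; under eq_map do rewrite perturbed0. Qed.

Lemma perturbed_interior j : interior U (perturbed j 0).
Proof. by rewrite perturbed0. Qed.

Let initc : forall p : 'rV[R]_(N * m), setT p -> cdom (ch 0) x0.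
Proof. by move=> *; exact: chart_at_cdom. Qed.

Let initcont : forall p : 'rV[R]_(N * m), setT p -> {for p, continuous (fun _ : 'rV[R]_(N * m) => x0)}.
Proof. by move=> p _; exact: cst_continuous_at. Qed.

Let initCk : Ck_on 2 [set: 'rV[R]_(N * m)] (X 0).
Proof. exact: (@Ck_on_cst R 'rV[R]_(N * m) 'rV[R]_n 2 setT y0). Qed.

Lemma X_base i : X i 0 = y_ i.
Proof. by rewrite /flow_coord flow_perturbed. Qed.

Lemma X_Ck i : exists D, [/\ open D, D 0,
  forall w, D w -> cdom (ch i) (flow f (fun=> x0) perturbed i w) & Ck_on 2 D (X i)].
Proof.
have [D [oD Dy Dc _ DC]] := flow_Ck f_C2 flow_perturbed (@openT _) I initc initcont initCk perturbed_interior perturbed_Ck i.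
by exists D.
Qed.

Lemma derive_XS i w : 'D_w (X i.+1) 0 = 'D_('D_w (X i) 0, perturb i w) (g i) (y_ i, u i).
Proof.
have := derive_flow_coordS f_C2 flow_perturbed (@openT _) I initc initcont initCk perturbed_interior perturbed_Ck i w.
by rewrite X_base perturbed0 derive_perturbed.
Qed.

Lemma hess_XS i w : hess (X i.+1) 0 w w = 'D_(hess (X i) 0 w w, 0) (g i) (y_ i, u i) +
  hess (g i) (y_ i, u i) ('D_w (X i) 0, perturb i w) ('D_w (X i) 0, perturb i w).
Proof.
have := hess_flow_coordS f_C2 flow_perturbed (@openT _) I initc initcont initCk perturbed_interior perturbed_Ck i w w.
by rewrite X_base perturbed0 derive_perturbed hess_perturbed.
Qed.

Definition Ysum w j := \sum_r perturb j w 0 r *: Yfield_nat S f u j r x0.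
Definition dYsum w j z := \sum_r perturb j w 0 r *: 'D_z (vY j r) y0.
Definition Zsum w j := \sum_r \sum_s (perturb j w 0 r * perturb j w 0 s) *: Zfield_nat S f u j r s x0.

Lemma dPhi_linear i : linear (fun z => 'D_z (Phi i) y0).
Proof. by move=> c z z'; apply: derive_dir_linear; exact: (Phi_differentiable f_C2). Qed.

Lemma dg_linear i : linear (fun z => 'D_z (g i) (y_ i, u i)).
Proof. by move=> c z z'; apply: derive_dir_linear; apply: (g_differentiable f_C2); exact: g_base. Qed.

Lemma hess_g_linearr i p : linear (hess (g i) (y_ i, u i) p).
Proof.
exact: (hess_linearr p (@step_dom_open _ _ _ _ _ _ _ f_C2 (ch i) (ch i.+1)) (g_Ck f_C2 x0 u i) (g_base S f x0 u_int i)).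
Qed.

Lemma hess_gC i p q : hess (g i) (y_ i, u i) p q = hess (g i) (y_ i, u i) q p.
Proof.
exact: (hessC (coords_rV n) p q (@step_dom_open _ _ _ _ _ _ _ f_C2 (ch i) (ch i.+1)) (g_base S f x0 u_int i) (g_Ck f_C2 x0 u i)).
Qed.

Lemma linear_additive (V W : lmodType R) (F : V -> W) : linear F -> forall x y, F (x + y) = F x + F y.
Proof. by move=> lF x y; have := lF 1 x y; rewrite !scale1r. Qed.

Lemma linear_comp (V W Z : lmodType R) (F : W -> Z) (G : V -> W) : linear F -> linear G -> linear (F \o G).
Proof. by move=> lF lG c x y; rewrite /= lG lF. Qed.

(** An instance of [variations]. The controls are affine in [w], so their second derivative
    contributes nothing; the preliminary identities expand each control direction and each vector
    sum in its components, which reduces the hypotheses to [Y_eq], [dY_eq] and [Z_eq]. *)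
Lemma endpoint_variation i w :
  'D_w (X i) 0 = 'D_(\sum_(0 <= j < i) Ysum w j) (Phi i) y0 /\
  hess (X i) 0 w w =
  'D_(\sum_(0 <= j < i) (Zsum w j + dYsum w j (\sum_(0 <= k < j) Ysum w k) +
       dYsum w j (\sum_(0 <= k < j) Ysum w k) + dYsum w j (Ysum w j))) (Phi i) y0 +
  hess (Phi i) y0 (\sum_(0 <= j < i) Ysum w j) (\sum_(0 <= j < i) Ysum w j).
Proof.
have plin := @pairl_is_linear R 'rV[R]_n 'rV[R]_m.
have prin := @pairr_is_linear R 'rV[R]_n 'rV[R]_m.
have pDa : linear (fun z : 'rV[R]_m => (0 : 'rV[R]_n, z)) by exact: prin.
have g_sum j : 'D_(0, perturb j w) (g j) (y_ j, u j) =
    \sum_r perturb j w 0 r *: 'D_(0, e_ r) (g j) (y_ j, u j).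
  exact: (linear_rV_sum (perturb j w) (linear_comp (dg_linear j) pDa)).
have hess_sumr j q : hess (g j) (y_ j, u j) q (0, perturb j w) =
    \sum_r perturb j w 0 r *: hess (g j) (y_ j, u j) q (0, e_ r).
  exact: (linear_rV_sum (perturb j w) (linear_comp (hess_g_linearr j q) pDa)).
have hess_suml j q : hess (g j) (y_ j, u j) (0, perturb j w) q =
    \sum_r perturb j w 0 r *: hess (g j) (y_ j, u j) (0, e_ r) q.
  by rewrite hess_gC hess_sumr; apply: eq_bigr => r _; rewrite hess_gC.
have Phi_sum j (c : 'I_m -> R) v : 'D_(\sum_r c r *: v r) (Phi j) y0 =
    \sum_r c r *: 'D_(v r) (Phi j) y0.
  exact: (linear_sum_scale c v (dPhi_linear j)).
have hessY_sum j q (c : 'I_m -> R) v : hess (g j) (y_ j, u j) q (\sum_r c r *: v r, 0) =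
    \sum_r c r *: hess (g j) (y_ j, u j) q (v r, 0).
  exact: (linear_sum_scale c v (linear_comp (hess_g_linearr j q) plin)).
apply: (@variations _ _ (fun i z => 'D_z (Phi i) y0)
  (fun i z => 'D_(z, 0) (g i) (y_ i, u i)) (fun i z z' => hess (Phi i) y0 z z')
  (fun i => hess (g i) (y_ i, u i)) (Ysum w) (Zsum w)
  (fun i => 'D_(0, perturb i w) (g i) (y_ i, u i))
  (fun i => 'D_w (X i) 0) (fun i => hess (X i) 0 w w) (dYsum w)
  (fun i => perturb i w)) => {i}.
- by move=> i; exact/linear_additive/dPhi_linear.
- by move=> i; apply: linear_additive; exact: (linear_comp (dg_linear i) plin).
- move=> i x; apply: linear_additive.
  have [D [oD Dy _ DC]] := Phi_Ck f_C2 x0 u_int i.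
  exact: (hess_linearr x oD DC Dy).
- move=> i x y; have [D [oD Dy _ DC]] := Phi_Ck f_C2 x0 u_int i.
  exact: (hessC (coords_rV n) x y oD Dy DC).
- by move=> i x; exact/linear_additive/hess_g_linearr.
- by move=> i x y; exact: hess_gC.
- by move=> i x; have := nbhs_singleton (derive_PhiS_near f_C2 x0 u_int i) x; rewrite Phi_base.
- by move=> i x y; exact: (hess_PhiS f_C2 x0 u_int).
- exact: derive0.
- exact: (@derive_cst R 'rV[R]_(N * m) 'rV[R]_n y0).
- exact: (@hess_cst R 'rV[R]_(N * m) 'rV[R]_n y0).
- move=> i; rewrite derive_XS -(linear_additive (dg_linear i)).
  by congr ('D_ _ _ _); congr pair; rewrite /= ?addr0 ?add0r.
- by move=> i; exact: hess_XS.
- move=> i; rewrite g_sum /Ysum Phi_sum.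
  by apply: eq_bigr => r _; rewrite (Y_eq f_C2 f_diffeo x0 u_int).
- move=> i x; rewrite hess_sumr /dYsum Phi_sum.
  have [D [oD Dy _ DC]] := Phi_Ck f_C2 x0 u_int i.+1.
  have -> : hess (Phi i.+1) y0 x (Ysum w i) =
      \sum_r perturb i w 0 r *: hess (Phi i.+1) y0 x (Yfield_nat S f u i r x0).
    exact: (linear_sum_scale _ _ (hess_linearr x oD DC Dy)).
  rewrite -big_split/=; apply: eq_bigr => r _.
  by rewrite -(dY_eq f_C2 f_diffeo x0 u_int) scalerDr.
- move=> i; rewrite !hess_suml /Zsum.
  have -> : 'D_(\sum_r \sum_s (perturb i w 0 r * perturb i w 0 s) *: Zfield_nat S f u i r s x0)
      (Phi i.+1) y0 = \sum_r perturb i w 0 r *: 'D_(\sum_s perturb i w 0 s *: Zfield_nat S f u i r s x0) (Phi i.+1) y0.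
    rewrite -Phi_sum; congr ('D_ _ _ _); apply: eq_bigr => r _.
    by rewrite scaler_sumr; apply: eq_bigr => s _; rewrite scalerA.
  rewrite -big_split/=; apply: eq_bigr => r _; rewrite -scalerDr; congr (_ *: _).
  rewrite Phi_sum hess_sumr /Ysum Phi_sum hessY_sum -big_split/=.
  apply: eq_bigr => s _; rewrite -scalerDr; congr (_ *: _).
  exact: (Z_eq f_C2 f_diffeo x0 u_int).
Qed.

End Endpoint.

(** * The theorem *)

Lemma sum_delta_mx (R : pzRingType) (V : lmodType R) p k (F : 'I_p -> 'I_k -> V) i s :
  \sum_j \sum_t delta_mx i s j t *: F j t = F i s.
Proof.
rewrite (bigD1 i)//= (bigD1 s)//= big1 => [|t ts]; last first.
  by rewrite mxE (negbTE ts) andbF scale0r.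
rewrite big1 => [|j ji]; last by apply: big1 => t _; rewrite mxE (negbTE ji) scale0r.
by rewrite mxE !eqxx scale1r !addr0.
Qed.

Section Final.
Context {R : realType} {n m N : nat} {M : topologicalType}.
Variable S : smooth_manifold R n M.
Variables (U : set 'rV[R]_m) (f : M -> 'rV[R]_m -> M).
Hypothesis f_C2 : has_Ck_extension S 2 U f.
Hypothesis f_diffeo : forall u, U u -> Ck_diffeo_onto_open S 2 (f^~ u).
Hypothesis N_gt0 : (0 < N)%N.
Variables (x0 : M) (ubar : N.-tuple 'rV[R]_m).
Hypothesis ubar_int : forall i, interior U (tnth ubar i).

Implicit Types w : 'rV[R]_(N * m).

(** The default value is the first control, so that every [u j] lies in the interior of [U], also
    for j >= N. *)
Let u j := nth (tnth ubar (Ordinal N_gt0)) ubar j.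
Local Notation traj := (traj f x0 u).
Local Notation ch i := (chart_at S (traj i)).
Local Notation y0 := (ch 0 x0).
Local Notation Phi := (flow_coord S f (cinv (ch 0)) (fun j _ => u j) traj).
Local Notation X := (flow_coord S f (fun _ : 'rV[R]_(N * m) => x0) (@perturbed _ _ u N) traj).
Local Notation vY i r := (vf_coord S (ch 0) (Yfield_nat S f u i r)).

Lemma nth_ubar (i : 'I_N) : u i = tnth ubar i.
Proof. by rewrite (tnth_nth (tnth ubar (Ordinal N_gt0))). Qed.

Lemma u_int j : interior U (u j).
Proof.
rewrite /u; case: (ltnP j N) => jN; last by rewrite nth_default// size_tuple.
by have := ubar_int (Ordinal jN); rewrite -nth_ubar.
Qed.

Lemma ctrl_take i : (i <= N)%N -> ctrl u i = take i ubar.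
Proof. by move=> iN; rewrite /ctrl map_nth_iota0// size_tuple. Qed.

Lemma YfieldE (i : 'I_N) r : Yfield S f ubar i r = Yfield_nat S f u i r.
Proof. by rewrite /Yfield /Ad_before /Yfield_nat ctrl_take ?nth_ubar// ltnW. Qed.

Lemma perturb_ord w (i : 'I_N) r : perturb (i : nat) w 0 r = vec_mx w i r :> R.
Proof. by rewrite /perturb row_nat_ord mxE. Qed.

Lemma Ycomb_sum w : Ycomb S f ubar x0 (vec_mx w) = \sum_(0 <= j < N) Ysum S f x0 u w j.
Proof.
rewrite big_mkord; apply: eq_bigr => i _; apply: eq_bigr => r _.
by rewrite perturb_ord YfieldE.
Qed.

Lemma lie_bracket_nat i r j s :
  lie_bracket S (Yfield_nat S f u i r) (Yfield_nat S f u j s) x0 =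
  'D_(Yfield_nat S f u i r x0) (vY j s) y0 - 'D_(Yfield_nat S f u j s x0) (vY i r) y0.
Proof.
rewrite /lie_bracket !JacE !vf_coord_chart_at.
rewrite (mulmx_jacobian _ (vY_differentiable f_C2 f_diffeo x0 u_int j s)).
by rewrite (mulmx_jacobian _ (vY_differentiable f_C2 f_diffeo x0 u_int i r)).
Qed.

Lemma dYsum_add w j x y : dYsum S f x0 u w j (x + y) = dYsum S f x0 u w j x + dYsum S f x0 u w j y.
Proof.
rewrite /dYsum -big_split/=; apply: eq_bigr => r _; rewrite -scalerDr; congr (_ *: _).
by have := derive_dir_linear 1 x y (vY_differentiable f_C2 f_diffeo x0 u_int j r); rewrite !scale1r.
Qed.

Lemma dYsum_sum w i j : dYsum S f x0 u w j (Ysum S f x0 u w i) =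
  \sum_r \sum_s (perturb i w 0 r * perturb j w 0 s) *: 'D_(Yfield_nat S f u i r x0) (vY j s) y0.
Proof.
rewrite exchange_big/=; apply: eq_bigr => s _.
have lin : linear (fun z => 'D_z (vY j s) y0).
  by move=> c z z'; apply: derive_dir_linear; exact: (vY_differentiable f_C2 f_diffeo x0 u_int).
rewrite [X in _ *: X](linear_sum_scale _ _ lin) scaler_sumr.
by apply: eq_bigr => r _; rewrite scalerA mulrC.
Qed.

(** The hypothesis is the vanishing sum required by [bracket_sum]; in the chart at [x0] the half
    brackets found there are those of [Zfield], summed with their coefficients. *)
Lemma Hform_sum w : Ycomb S f ubar x0 (vec_mx w) = 0 -> Hform S f ubar x0 (vec_mx w) =
  \sum_(0 <= j < N) (Zsum S f x0 u w j + dYsum S f x0 u w j (\sum_(0 <= k < j) Ysum S f x0 u w k) +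
       dYsum S f x0 u w j (\sum_(0 <= k < j) Ysum S f x0 u w k) +
       dYsum S f x0 u w j (Ysum S f x0 u w j)).
Proof.
rewrite Ycomb_sum => Y0; rewrite (bracket_sum _ (dYsum_add w) Y0).
apply: eq_bigr => i _; apply: eq_bigr => j _.
have lt_case (k l : 'I_N) : (k < l)%N ->
    \sum_r \sum_s (vec_mx w k r * vec_mx w l s) *:
      (2^-1 *: lie_bracket S (Yfield S f ubar k r) (Yfield S f ubar l s) x0) =
    2^-1 *: (dYsum S f x0 u w l (Ysum S f x0 u w k) - dYsum S f x0 u w k (Ysum S f x0 u w l)).
  move=> kl; rewrite !dYsum_sum [X in _ - X]exchange_big/= -sumrB scaler_sumr.
  apply: eq_bigr => r _; rewrite -sumrB scaler_sumr; apply: eq_bigr => s _.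
  rewrite !YfieldE lie_bracket_nat !perturb_ord [vec_mx w l s * _]mulrC.
  by rewrite -scalerBr !scalerA mulrC.
case: ifPn => [ij|ij].
  by rewrite -lt_case//; apply: eq_bigr => r _; apply: eq_bigr => s _; rewrite /Zfield ij.
case: ifPn => [ji|ji].
  rewrite -lt_case// exchange_big/=; apply: eq_bigr => r _; apply: eq_bigr => s _.
  by rewrite /Zfield (negbTE ij) ji mulrC.
have {ij ji} <- : i = j.
  by apply/val_inj/eqP; rewrite eqn_leq leqNgt ji leqNgt ij.
apply: eq_bigr => r _; apply: eq_bigr => s _.
rewrite /Zfield ltnn !perturb_ord; congr (_ *: _).
by rewrite /Ad_before /Zfield_nat ctrl_take ?nth_ubar// ltnW.
Qed.

Lemma first_variation w : 'D_w (X N) 0 = 'D_(Ycomb S f ubar x0 (vec_mx w)) (Phi N) y0.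
Proof. by rewrite Ycomb_sum; have [-> _] := endpoint_variation f_C2 f_diffeo x0 u_int N w. Qed.

Lemma second_variation w : Ycomb S f ubar x0 (vec_mx w) = 0 ->
  hess (X N) 0 w w = 'D_(Hform S f ubar x0 (vec_mx w)) (Phi N) y0.
Proof.
move=> Y0; rewrite (Hform_sum Y0).
have [_ ->] := endpoint_variation f_C2 f_diffeo x0 u_int N w.
rewrite -Ycomb_sum Y0 [hess (Phi N) _ _ _]derive0.
by rewrite addr0.
Qed.

(** Small perturbations keep all controls in [U], so their end points are reachable. Were these to
    fill a neighbourhood in the chart, its preimage would be a neighbourhood of the end point inside
    the reachable set. *)
Lemma endpoint_not_open : ~ interior (reachable f U x0 N) (foldl f x0 (take N ubar)) ->
  exists (D : set 'rV[R]_(N * m)) r, [/\ open D, Ck_on 2 D (X N), 0 < r,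
    forall w, `|w| <= r -> D w &
    ~ nbhs (X N 0) (X N @` [set w | `|w| <= r])].
Proof.
move=> nI; have [D [oD D0 Dc DC]] := X_Ck f_C2 x0 u_int N N.
have nD : \forall w \near (0 : 'rV[R]_(N * m)), D w by exact: open_nbhs_nbhs.
have nUi (i : 'I_N) : \forall w \near (0 : 'rV[R]_(N * m)), interior U (perturbed u i w).
  have cc : {for (0 : 'rV[R]_(N * m)), continuous (fun w : 'rV[R]_(N * m) => perturbed u i w)}.
    exact: (c_continuous (perturbed_Ck u N)).
  exact: (near_preimage_open cc (@open_interior _ U) (perturbed_interior u_int N i)).
have nU : \forall w \near (0 : 'rV[R]_(N * m)), forall i : 'I_N, interior U (perturbed u i w).
  exact: (filter_forall _ nUi).
have /nbhs_ballP[e /= e0 He] : \forall w \near (0 : 'rV[R]_(N * m)), D w /\ forall i : 'I_N, interior U (perturbed u i w).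
  exact: filterI.
(* Half the radius, because the minimisation uses a closed ball and the neighbourhood is an open
   one. *)
have e2 : 0 < e / 2 by rewrite divr_gt0.
have Hr w : `|w| <= e / 2 -> D w /\ forall i : 'I_N, interior U (perturbed u i w).
  move=> we; apply: He; rewrite -ball_normE/= sub0r normrN (le_lt_trans we)//.
  by rewrite ltr_pdivrMr// ltr_pMr// ltr1n.
exists D, (e / 2); split => //; first by move=> w /Hr[].
move=> nI'; apply: nI.
rewrite -ctrl_take// -/(traj N).
have xN : cdom (ch N) (traj N) by exact: chart_at_cdom.
have n1 : \forall p \near traj N, cdom (ch N) p.
  by apply: open_nbhs_nbhs; split => //; exact: cdom_open.
have n2 : \forall p \near traj N, (X N @` [set w | `|w| <= e / 2]) (ch N p).
  apply: (cmap_continuous xN).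
  by move: nI'; rewrite (X_base S f x0 u N N).
apply: filterS2 n1 n2 => p pN [w we wp].
have [Dw Uw] := Hr w we.
exists (map_tuple (fun j => perturbed u j w) (iota_tuple N 0)).
  move=> j; rewrite tnth_map; apply: interior_sub.
  have : tnth (iota_tuple N 0) j \in iota 0 N by exact: mem_tnth.
  by rewrite mem_iota add0n => /andP[_ jN]; exact: (Uw (Ordinal jN)).
rewrite /= -[LHS]/(flow f (fun=> x0) (@perturbed _ _ u N) N w).
rewrite -(cmapK (Dc _ Dw)) -[RHS](cmapK pN).
by congr (cinv _ _); exact: wp.
Qed.

(** The covector is pulled back by the isomorphism DPhi_N, which turns the derivatives of the end
    point map into [Ycomb] and, on the kernel, into [Hform]. *)
Lemma multiplier : ~ interior (reachable f U x0 N) (foldl f x0 (take N ubar)) ->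
  exists lam : 'Hom('rV[R]_n, R^o),
  [/\ lam != 0, annihilator (Lsub S f ubar x0) lam &
   forall V : {vspace 'M[R]_(N, m)}, (V <= Ksub S f ubar x0)%VS ->
     (forall a, a \in V -> a != 0 -> lamH S f ubar x0 lam a < 0) ->
     (\dim V < codimv (Lsub S f ubar x0))%N].
Proof.
move=> /endpoint_not_open[D [r [oD DC r0 rD nF]]].
have [l [l1 lF lV]] := second_order_necessary oD DC r0 rD nF.
have [_ _ dP JU _] := nbhs_singleton (near_flow f_C2 f_diffeo x0 u_int N).
have lin : linear (fun z : 'rV[R]_n => (dot l ('D_z (Phi N) y0) : R^o)).
  by move=> c z z'; rewrite derive_dir_linear// linearP.
pose lL : {linear 'rV[R]_n -> R^o} := HB.pack (fun z : 'rV[R]_n => (dot l ('D_z (Phi N) y0) : R^o))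
  (GRing.isLinear.Build R 'rV[R]_n R^o _ _ lin).
pose lam : 'Hom('rV[R]_n, R^o) := linfun lL.
have lamE z : lam z = dot l ('D_z (Phi N) y0) by rewrite lfunE.
have Phi_inj z : 'D_z (Phi N) y0 = 0 -> z = 0.
  move=> z0; have := mulmx_jacobian z dP; rewrite z0 => E.
  by rewrite -[z](mulmxK JU) E mul0mx.
have YE (a : 'M[R]_(N, m)) : 'D_(mxvec a) (X N) 0 = 'D_(Ycomb S f ubar x0 a) (Phi N) y0.
  by rewrite first_variation mxvecK.
have annY a : lam (Ycomb S f ubar x0 a) = 0 by rewrite lamE -YE lF.
exists lam; split.
- apply/eqP => lam0.
  (* The tested vector is the preimage of [l] under DPhi_N, and [l] has length one. *)
  have : lam (l *m invmx (Jac (Phi N) y0)) = 1.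
    by rewrite lamE -(mulmx_jacobian _ dP) mulmxKV.
  by rewrite lam0 lfunE/= => /eqP; rewrite eq_sym oner_eq0.
- move=> v vL; apply/eqP; rewrite -[_ == 0]memv_ker; apply: subvP vL.
  rewrite /Lsub; apply/span_subvP => _ /mapP[[i s] _ ->]; rewrite memv_ker /=.
  have <- : Ycomb S f ubar x0 (delta_mx i s) = Yfield S f ubar i s x0.
    exact: (sum_delta_mx (fun j t => Yfield S f ubar j t x0)).
  by rewrite annY.
- move=> V VK Vneg.
  pose T : 'Hom('M[R]_(N, m), 'rV[R]_(N * m)) := linfun mxvec.
  have TE a : T a = mxvec a by rewrite lfunE.
  have T0 : lker T = 0%VS.
    apply/eqP/lker0P => a b; rewrite !TE => ab.
    by rewrite -[a]mxvecK ab mxvecK.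
  have dimT W : \dim (T @: W) = \dim W by apply: limg_dim_eq; rewrite T0 capv0.
  (* The complement [K^C] plays the part of [C] in [second_order_necessary]: [Ycomb] is injective on
     it and DPhi_N is injective. Its dimension is the rank of [Ycomb], which is at least dim L. *)
  pose K := Ksub S f ubar x0.
  have := lV (T @: V)%VS (T @: K^C)%VS.
  rewrite !dimT => H.
  have {H} VC : (\dim V + \dim K^C < n)%N.
    apply: H.
    + move=> _ /memv_imgP[a aV ->]; rewrite TE YE.
      by have := subvP VK _ aV; rewrite mem_Ksub => /eqP ->; rewrite derive0.
    + move=> _ /memv_imgP[a aV ->]; rewrite TE => a0.
      have := subvP VK _ aV; rewrite mem_Ksub => /eqP Ya.
      rewrite second_variation mxvecK// -lamE; apply: Vneg => //.
      by apply: contraNneq a0 => ->; rewrite linear0.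
    + move=> _ /memv_imgP[a aC ->]; rewrite TE YE => /Phi_inj Ya.
      have aK : a \in K by rewrite mem_Ksub Ya.
      have : a \in (K :&: K^C)%VS by rewrite memv_cap aK.
      by rewrite capv_compl memv0 => /eqP ->; rewrite linear0.
  have LK : (\dim (Lsub S f ubar x0) <= \dim K^C)%N.
    have sub : (Lsub S f ubar x0 <= limg (linfun (Ycomb S f ubar x0)))%VS.
      apply/span_subvP => _ /mapP[[i s] _ ->] /=.
      have <- : linfun (Ycomb S f ubar x0) (delta_mx i s) = Yfield S f ubar i s x0.
        rewrite lfunE; exact: (sum_delta_mx (fun j t => Yfield S f ubar j t x0)).
      exact: memv_img (memvf _).
    apply: leq_trans (dimvS sub) _.
    have := limg_ker_dim (linfun (Ycomb S f ubar x0)) fullv; rewrite capfv -/K.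
    by rewrite dimv_compl => <-; rewrite addKn.
  have dimn : \dim {:'rV[R]_n} = n by rewrite dimvf /dim/= mul1n.
  rewrite /codimv dimn ltn_subRL addnC; apply: leq_ltn_trans VC.
  by rewrite leq_add2l.
Qed.

End Final.

(** In the uniqueness claim, if lam H vanishes identically on K then -lam satisfies the same
    conditions as lam; positivity of the factor is therefore asserted when lam H is nonzero
    somewhere on K. *)
Theorem theorem6 (R : realType) (n m N : nat) (M : topologicalType)
  (S : smooth_manifold R n M)
  (U : set 'rV[R]_m)
  (f : M -> 'rV[R]_m -> M)
  (U_int : interior U !=set0)
  (U_cl : U `<=` closure (interior U))
  (f_C2 : has_Ck_extension S 2 U f)
  (f_diffeo : forall u, U u -> Ck_diffeo_onto_open S 2 (f^~ u))
  (N_gt0 : (0 < N)%N)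
  (x0 : M) (ubar : N.-tuple 'rV[R]_m)
  (ubar_int : forall i, interior U (tnth ubar i)) :
  let L := Lsub S f ubar x0 in
  let K := Ksub S f ubar x0 in
  let Q := lamH S f ubar x0 in
  [/\ geometrically_optimal f U x0 ubar ->
        exists lam : 'Hom('rV[R]_n, R^o),
          [/\ lam != 0, annihilator L lam
            & (neg_index (Q lam) K < codimv L)%N],
      L = fullv -> ~ geometrically_optimal f U x0 ubar
    & codimv L = 1%N -> geometrically_optimal f U x0 ubar ->
        exists lam : 'Hom('rV[R]_n, R^o),
          [/\ lam != 0, annihilator L lam,
              (forall a, a \in K -> 0 <= Q lam a)
            & forall mu : 'Hom('rV[R]_n, R^o),
                mu != 0 -> annihilator L mu ->
                (forall a, a \in K -> 0 <= Q mu a) ->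
                exists2 c : R, mu = c *: lam &
                  ((exists2 a, a \in K & Q lam a != 0) -> 0 < c)]].
Proof.
move=> L K Q.
have main : geometrically_optimal f U x0 ubar -> exists lam : 'Hom('rV[R]_n, R^o),
    [/\ lam != 0, annihilator L lam & forall V : {vspace 'M[R]_(N, m)}, (V <= K)%VS ->
     (forall a, a \in V -> a != 0 -> Q lam a < 0) -> (\dim V < codimv L)%N].
  move=> /(_ N); rewrite N_gt0 leqnn => /(_ isT)[_ nI].
  exact: (multiplier f_C2 f_diffeo N_gt0 ubar_int nI).
have bound : geometrically_optimal f U x0 ubar -> exists lam : 'Hom('rV[R]_n, R^o),
    [/\ lam != 0, annihilator L lam & (neg_index (Q lam) K < codimv L)%N].
  move=> /main[lam [lam0 Llam HV]]; exists lam; split => //.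
  rewrite /neg_index; elim/big_ind : _ => [|d d' Hd Hd'|d /asboolP[W [WK <- Wneg]]].
  (* The empty maximum is 0, and the bound for the zero subspace gives 0 < codim L. This strict
     inequality also settles the case where L is the whole space. *)
  - have := HV 0%VS (sub0v _); rewrite dimv0; apply.
    by move=> a; rewrite memv0 => ->.
  - by rewrite gtn_max Hd.
  - exact: HV.
split => //.
- move=> LT /bound[lam [_ _]]; rewrite LT /codimv subnn.
  by rewrite ltn0.
move=> c1 /main[lam [lam0 Llam HV]]; exists lam.
have pos a : a \in K -> 0 <= Q lam a.
  move=> aK; rewrite leNgt; apply/negP => neg.
  have a0 : a != 0.
    apply: contraTneq neg => ->.
    rewrite /Q /lamH /Hform big1 ?linear0 ?ltxx// => i _.
    by apply: big1 => j _; apply: big1 => s _; apply: big1 => t _; rewrite mxE mul0r scale0r.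
  (* A single negative vector spans a negative line, whose dimension 1 is not less than the
     codimension 1. *)
  have := HV <[a]>%VS; rewrite dim_vline a0 c1 ltnn => H.
  suff : false by []; apply: H; first by rewrite -memvE.
  move=> _ /vlineP[c ->] c0.
  have -> : Q lam (c *: a) = c ^+ 2 * Q lam a.
    rewrite /Q /lamH -[RHS]/(c ^+ 2 *: lam _) -linearZ; congr (lam _).
    rewrite /Hform scaler_sumr; apply: eq_bigr => i _.
    rewrite scaler_sumr; apply: eq_bigr => j _.
    rewrite scaler_sumr; apply: eq_bigr => s _.
    rewrite scaler_sumr; apply: eq_bigr => t _.
    by rewrite !mxE scalerA; congr (_ *: _); ring.
  rewrite pmulr_rlt0// exprn_even_gt0//=.
  by apply: contraNneq c0 => ->; rewrite scale0r.
split => // mu mu0 Lmu mupos.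
(* Such a [v] lies outside L and, the codimension being 1, spans a complement of L. Covectors
   vanishing on L are determined by their value at [v], whence the factor mu v / lam v. *)
have [v lv] : exists v, lam v != 0.
  apply: contrapT => H; move/eqP: lam0; apply; apply/lfunP => v; rewrite lfunE/=.
  by apply/eqP; apply: contra_notT H => H; exists v.
have vL : v \notin L by apply: contraNN lv => /Llam ->.
have full : (L + <[v]>)%VS = fullv.
  apply/eqP; rewrite eqEdim subvf/= dimv_disjoint_sum; last first.
    apply/eqP; rewrite -subv0; apply/subvP => x; rewrite memv_cap memv0.
    move=> /andP[xL /vlineP[k xk]]; rewrite xk; move: xL; rewrite xk.
    have [->|k0] := eqVneq k 0; first by rewrite scale0r eqxx.
    move=> kL; have : v \in L by rewrite -(scalerK k0 v) memvZ.
    by rewrite (negbTE vL).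
  rewrite dim_vline; have -> : v != 0 by apply: contraNneq vL => ->; rewrite mem0v.
  by move: c1; rewrite /codimv; lia.
exists (mu v / lam v).
  apply/lfunP => x; rewrite lfunE/=.
  have /memv_addP[y yL [z /vlineP[k ->] ->]] : x \in (L + <[v]>)%VS by rewrite full memvf.
  rewrite !linearD/= !linearZ/= (Llam y yL) (Lmu y yL) !add0r.
  rewrite /GRing.scale/=; field; exact: lv.
move=> [a aK Qa].
have muE : Q mu a = mu v / lam v * Q lam a.
  rewrite /Q /lamH.
  have /memv_addP[y yL [z /vlineP[k ->] ->]] : Hform S f ubar x0 a \in (L + <[v]>)%VS by rewrite full memvf.
  rewrite !linearD/= !linearZ/= (Llam y yL) (Lmu y yL) !add0r.
  rewrite /GRing.scale/=; field; exact: lv.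
have Qpos : 0 < Q lam a by rewrite lt_neqAle eq_sym Qa pos.
(* The factor is nonnegative because both forms are nonnegative at [a] and that of [lam] is
   positive. If it were zero, [mu] would vanish at [v] and on L, hence everywhere. *)
have := mupos a aK; rewrite muE pmulr_lge0// le_eqVlt => /predU1P[mv|//].
exfalso; move/eqP: mu0; apply; apply/lfunP => x; rewrite lfunE/=.
have /memv_addP[y yL [z /vlineP[k ->] ->]] : x \in (L + <[v]>)%VS by rewrite full memvf.
rewrite linearD/= linearZ/= (Lmu y yL) add0r.
move: mv => /esym/eqP; rewrite mulf_eq0 invr_eq0 (negbTE lv) orbF => /eqP ->.
by rewrite scaler0.
Qed.
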